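(* For any triangle-free outerplanar graph $G$, $\chi_{vi,1}(G)\leq \Delta(G)+3$.
   Context: All graphs are finite, simple and undirected. An incidence of $G$ is a pair $(v,e)$ with $v\in V(G)$, $e\in E(G)$, $v\in e$; $I(G)$ is the set of incidences. Let $G^{1/3}$ be obtained from $G$ by replacing each edge $e=\{u,v\}$ by the path $u,(u,e),(v,e),v$. A $vi$-simultaneous proper $k$-coloring of $G$ is a map $c:V(G)\cup I(G)\to\{1,\dots,k\}$ such that any two distinct elements at distance at most $3$ in $G^{1/3}$ receive distinct colors. For a vertex $v$, $I_2(v)=\{(u,\{u,v\}) : u\in N_G(v)\}$. Such a coloring is a $(k,s)$-coloring if for every vertex $v$ at most $s$ distinct colors appear on $I_2(v)$; $\chi_{vi,s}(G)$ is the least such $k$. A graph is triangle-free if it contains no cycle of length $3$. A graph is outerplanar if it has a planar drawing with all vertices on the outer face. *)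

(* Defs.v *)
From HB Require Import structures.
From mathcomp Require Import all_boot all_order all_algebra.
From mathcomp Require Import all_classical all_reals all_analysis.

Set Implicit Arguments.
Unset Strict Implicit.
Unset Printing Implicit Defensive.

Import Order.TTheory GRing.Theory Num.Theory.
Import numFieldNormedType.Exports.

Record sgraph := SGraph {
  vertex :> finType;
  adj : rel vertex;
  adj_sym : symmetric adj;
  adj_irrefl : irreflexive adj
}.

Section Graphs.
Variable G : sgraph.

Definition neighbours (v : G) : {set G} := [set u | adj v u]%SET.

Definition max_degree : nat := \max_(v : G) #|neighbours v|.

Definition edges : {set {set G}} :=
  [set E : {set G} | [exists u, exists v, adj u v && (E == [set u; v]%SET)]]%SET.

Definition triangle_free : Prop :=
  ~ exists c : seq G, size c = 3 /\ ucycle (@adj G) c.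

Definition dist_le (d : nat) (x y : G) : Prop :=
  exists p : seq G, [/\ path (@adj G) x p, last x p = y & size p <= d].

End Graphs.

Section Incidences.
Variable G : sgraph.

Definition incidence :=
  {i : G * {set G} | (i.2 \in edges G) && (i.1 \in i.2)}.

Definition inc_vertex (i : incidence) : G := (val i).1.
Definition inc_edge (i : incidence) : {set G} := (val i).2.

(* V(G) ∪ I(G); both the vertex set of G^{1/3} and the domain of a
   vi-simultaneous colouring. *)
Definition vi_elt : finType := (G + incidence)%type.

(* Each edge e = {u, v} becomes the path u, (u,e), (v,e), v. *)
Definition third_adj : rel vi_elt := fun x y =>
  match x, y with
  | inl _, inl _ => false
  | inl u, inr i | inr i, inl u => inc_vertex i == u
  | inr i, inr j =>
      (inc_edge i == inc_edge j) && (inc_vertex i != inc_vertex j)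
  end.

Lemma third_adj_sym : symmetric third_adj.
Proof. by case=> [u|i] [v|j] //=; rewrite eq_sym [X in _ && ~~ X]eq_sym. Qed.

Lemma third_adj_irrefl : irreflexive third_adj.
Proof. by case=> [u|i] //=; rewrite !eqxx. Qed.

Definition third_subdivision : sgraph := SGraph third_adj_sym third_adj_irrefl.

Definition I2 (v : G) : {set incidence} :=
  [set i : incidence | (inc_vertex i \in neighbours v)
                       && (inc_edge i == [set inc_vertex i; v]%SET)]%SET.

Definition vi_proper (k : nat) (c : vi_elt -> 'I_k) : Prop :=
  forall x y : vi_elt, x <> y -> @dist_le third_subdivision 3 x y -> c x <> c y.

Definition vi_coloring (k s : nat) (c : vi_elt -> 'I_k) : Prop :=
  vi_proper c /\ forall v : G, #|[set c (inr i) | i in I2 v]%SET| <= s.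

Definition vi_colorable (s k : nat) : bool :=
  `[< exists c : vi_elt -> 'I_k, vi_coloring s c >].

Lemma inc_edgeE (i : incidence) :
  inc_edge i = (inc_vertex i |: (inc_edge i :\ inc_vertex i))%SET.
Proof. by rewrite finset.setD1K //; case/andP: (valP i). Qed.

Lemma inc_eq (i j : incidence) :
  inc_vertex i = inc_vertex j -> inc_edge i = inc_edge j -> i = j.
Proof.
move=> eqv eqe; apply: val_inj; move: eqv eqe; rewrite /inc_vertex /inc_edge.
by case: (val i) (val j) => ? ? [? ?] /= -> ->.
Qed.

Lemma vi_colorable_exists (s : nat) : 0 < s -> exists k, vi_colorable s k.
Proof.
move=> s_gt0.
pose C : finType := (G + {set G})%type.
pose f (x : vi_elt) : C := match x with
  | inl v => inl v
  | inr i => inr (inc_edge i :\ inc_vertex i)%SET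
  end.
exists #|C|; apply/asboolP; exists (enum_rank \o f); split=> [x y neq_xy|v].
  case=> p [pth lst sz] /enum_rank_inj.
  case: x y neq_xy pth lst => [u|i] [v|j] neq_xy pth lst //=.
    by case=> uv; apply: neq_xy; rewrite uv.
  case=> eqD.
  have eqv : inc_vertex i = inc_vertex j -> False.
    move=> ev; apply: neq_xy; congr inr; apply: inc_eq => //.
    by rewrite (inc_edgeE i) eqD ev -inc_edgeE.
  have eqe : inc_edge i = inc_edge j -> False.
    move=> ee; apply: eqv; apply/eqP; apply: contraT => ne.
    have : inc_vertex i \in (inc_edge j :\ inc_vertex j)%SET.
      by rewrite !inE ne -ee; case/andP: (valP i).
    by rewrite -eqD !inE eqxx.
  have key (a b : incidence) :
      (inc_edge a :\ inc_vertex a = inc_edge b :\ inc_vertex b)%SET ->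
      inc_vertex a \in inc_edge b -> inc_vertex a = inc_vertex b.
    move=> eab ab; apply/eqP; apply: contraT => ne.
    have : inc_vertex a \in (inc_edge b :\ inc_vertex b)%SET by rewrite !inE ne.
    by rewrite -eab !inE eqxx.
  have inE' (a : incidence) : inc_vertex a \in inc_edge a.
    by case/andP: (valP a).
  case: p sz pth lst => [_ _ [ij]|a [|b [|c [|d p]]]] //=.
  - by apply: neq_xy; rewrite ij.
  - by move=> _ /andP[+ _] aj; rewrite aj => /andP[/eqP/eqe].
  - move=> _ /and3P[ia ab _] bj; move: ab; rewrite bj.
    case: a ia => [x|m] /=.
      by move=> /eqP<- /eqP/esym/eqv.
    by move=> /andP[/eqP<- _] /andP[/eqP/eqe].
  - move=> _ /and4P[ia ab bc _] cj; move: bc; rewrite cj.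
    case: a ia ab => [x|m] /= => [/eqP ix|/andP[/eqP im _]].
      case: b => [//|m] /= /eqP mx /andP[/eqP mj _].
      by apply/eqv/(key _ _ eqD); rewrite ix -mx -mj.
    case: b => [x|m'] /=.
      move=> /eqP mx /eqP jx; apply/eqv/esym/(key _ _ (esym eqD)).
      by rewrite jx -mx im.
    by move=> /andP[/eqP mm' _] /andP[/eqP mj _]; apply: eqe; rewrite im mm'.
apply: leq_trans s_gt0.
rewrite -(cards1 (enum_rank (inr [set v]%SET : C))); apply: subset_leq_card.
apply/fintype.subsetP => _ /imsetP[i + ->]; rewrite !inE => /andP[vi /eqP ei].
apply/eqP; congr enum_rank; congr inr; rewrite ei.
apply/setP => w; rewrite !inE; case: eqVneq => [->|//] /=.
by apply/esym/negbTE; apply: contraL vi => /eqP->; rewrite adj_irrefl.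
Qed.

(* For s = 0 a graph with an edge has no (k, s)-colouring, hence 0 < s. *)
Definition chi_vi (s : nat) (s_gt0 : 0 < s) : nat :=
  ex_minn (vi_colorable_exists s_gt0).

End Incidences.

Section Outerplanar.
Local Open Scope classical_set_scope.
Local Open Scope ring_scope.
Variables (R : realType) (G : sgraph).

(* Vertices are distinct points of the plane; an edge e is the simple arc
   arc e on [0, 1], joining the points of its two ends.  The values of
   arc outside edges G and outside [0, 1] are irrelevant. *)
Definition plane_drawing (pos : G -> R * R) (arc : {set G} -> R -> R * R) : Prop :=
  [/\ injective pos,
      forall e, e \in edges G ->
        [/\ {within `[0, 1], continuous (arc e)},
            set_inj `[0, 1] (arc e)
          & [set arc e 0; arc e 1] = pos @` [set` e]],
      forall e, e \in edges G ->
        arc e @` `]0, 1[ `&` range pos = set0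
    & forall e e', e \in edges G -> e' \in edges G -> e != e' ->
        arc e @` `]0, 1[ `&` arc e' @` `]0, 1[ = set0].

Definition drawing_image (pos : G -> R * R) (arc : {set G} -> R -> R * R) :
    set (R * R) :=
  range pos `|` \bigcup_(e in [set` edges G]) (arc e @` `[0, 1]).

Definition outer_face (D F : set (R * R)) : Prop :=
  (exists2 x, (~` D) x & F = connected_component (~` D) x) /\ ~ bounded_set F.

Definition outerplanar : Prop :=
  exists pos arc, plane_drawing pos arc /\
    exists2 F, outer_face (drawing_image pos arc) F
             & forall v : G, (closure F `\` interior F) (pos v).

End Outerplanar.

Arguments chi_vi G s s_gt0 : clear implicits.
Arguments outerplanar R G : clear implicits.

(* Main.v *)
(** Write f v for the common colour of I2 v and g v for the colour of v.  A
    (k, 1)-colouring then amounts to f being injective on every set of pairwise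
    distance at most 2 and g being a proper colouring with g v outside
    f (N[v]).

    An outerplanar graph has no K_{2,3} minor: joining a point of the outer
    face to the three small branch sets would give a drawing of K_{3,3} in
    which independent edges are disjoint, and a parity count of winding numbers
    mod 2 forbids this, even for edges that are merely fine chains of points.

    Without triangles and K_{2,3} minors, a graph of minimum degree at least 2
    has a pendant face, hence either a 4-cycle with two adjacent vertices of
    degree 2 or three consecutive vertices of degree 2.  After deleting these,
    or a vertex of degree at most 1, a colouring with D + 3 colours extends
    greedily as soon as D is at least 3.  For D = 2 the remaining components
    are cycles, coloured by periodic words. *)

Require Import Defs.
From mathcomp Require Import all_boot all_order all_algebra.
From mathcomp Require Import zify lra ring.
From mathcomp Require Import boolp.

Set Implicit Arguments.
Unset Strict Implicit.
Unset Printing Implicit Defensive.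

Import Order.TTheory GRing.Theory Num.Theory.

(** * Connected vertex sets and minors *)

Section ConnectedSets.
Variable G : sgraph.
Implicit Types (X Y Z : {set G}) (x y z : G).

(** The count behind [D + 3]: a new vertex [u] with one coloured neighbour [x] must have [f u]
    different from [f x], [g x] and at most [D - 1] values of [f] at the other neighbours of [x].
    That excludes [D + 1] colours and leaves room for one more exclusion. For adjacent [u], [v] of
    degree 2 with outer neighbours [x], [y], the value [f u] must also avoid [f y], and [f v] must
    avoid [f x] and [f u]. The count allows this when [x] and [y] are adjacent, as [f y] is then
    already counted around [x] and [f x] around [y]; otherwise a third vertex of degree 2 keeps the
    two ends apart. In the plane, arcs are merely continuous and a boundary point of a face may fail
    to be the end of a curve inside the face. The way around this is that only edges of K_{3,3}
    without a common end have to stay apart: the edge from the hub to a vertex may finish with a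
    straight segment that crosses the sets belonging to that same vertex. *)

Definition touch X Y := [exists x in X, exists y in Y, adj x y].

(** Connectedness by cuts rather than walks, so that uniting and splitting branch sets needs no
    paths. *)
Definition conn X :=
  X != set0 /\
  forall A : {set G}, A != set0 -> A \subset X -> A != X -> touch A (X :\: A).

Lemma touchP X Y : reflect (exists x y, [/\ x \in X, y \in Y & adj x y]) (touch X Y).
Proof.
apply: (iffP existsP) => [[x /andP[xX /existsP[y /andP[yY xy]]]]|[x [y [xX yY xy]]]].
  by exists x, y.
by exists x; rewrite xX; apply/existsP; exists y; rewrite yY.
Qed.

Lemma touchC X Y : touch X Y = touch Y X.
Proof.
by apply/touchP/touchP => -[x [y [xX yY xy]]]; exists y, x; split; rewrite // adj_sym.
Qed.

Lemma touchS X X' Y Y' : X \subset X' -> Y \subset Y' -> touch X Y -> touch X' Y'.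
Proof.
move=> sX sY /touchP[x [y [xX yY xy]]]; apply/touchP; exists x, y.
by split; [exact: subsetP xX|exact: subsetP yY|].
Qed.

Lemma conn1 x : conn [set x].
Proof.
split; first by apply/set0Pn; exists x; rewrite inE.
move=> A A0; rewrite subset1 => /orP[/eqP->|/eqP AE]; first by rewrite eqxx.
by rewrite AE eqxx in A0.
Qed.

Lemma connU X Y : conn X -> conn Y -> touch X Y -> conn (X :|: Y).
Proof.
move=> [X0 cX] [Y0 cY] /touchP[x [y [xX yY xy]]]; split.
  by apply: contraNneq X0 => /eqP; rewrite setU_eq0 => /andP[].
move=> A A0 sA neA.
wlog xA : X Y x y X0 cX Y0 cY xX yY xy sA neA / x \in A => [IH|].
  have [|nxA] := boolP (x \in A); first exact: (IH X Y x y).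
  have [yA|nyA] := boolP (y \in A).
    rewrite setUC; apply: (IH Y X y x) => //; rewrite 1?setUC //.
    by rewrite adj_sym.
  have /set0Pn[z zA] := A0; have : z \in X :|: Y by apply: subsetP zA.
  (* If [A] misses both ends of the edge [xy], it meets [X] or [Y] in a proper part, since each of
     these sets has its end outside [A]. *)
  have key Z w : (forall A : {set G}, A != set0 -> A \subset Z -> A != Z -> touch A (Z :\: A)) ->
      Z \subset X :|: Y -> w \in Z -> w \notin A -> z \in Z -> touch A ((X :|: Y) :\: A).
    move=> cZ sZ wZ nwA zZ.
    have : touch (A :&: Z) (Z :\: (A :&: Z)).
      apply: cZ; rewrite ?subsetIr //; first by apply/set0Pn; exists z; rewrite inE zA.
      by apply: contraNneq nwA => e; move: wZ; rewrite -{1}e inE => /andP[].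
    by rewrite setDIr setDv setU0; apply: touchS; [exact: subsetIl|exact: setSD].
  rewrite inE => /orP[zX|zY]; first exact: (key X x cX (subsetUl _ _)).
  exact: (key Y y cY (subsetUr _ _)).
have [sX|nsX] := boolP (X \subset A); last first.
  have : touch (A :&: X) (X :\: (A :&: X)).
    apply: cX; rewrite ?subsetIr //; first by apply/set0Pn; exists x; rewrite inE xA.
    by apply: contraNneq nsX => <-; apply: subsetIl.
  rewrite setDIr setDv setU0; apply: touchS; first exact: subsetIl.
  exact/setSD/subsetUl.
have [yA|nyA] := boolP (y \in A); last first.
  by apply/touchP; exists x, y; rewrite !inE yY nyA orbT.
have : touch (A :&: Y) (Y :\: (A :&: Y)).
  apply: cY; rewrite ?subsetIr //; first by apply/set0Pn; exists y; rewrite inE yA.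
  apply: contraNneq neA => e; rewrite eqEsubset sA subUset sX -e; exact: subsetIl.
rewrite setDIr setDv setU0; apply: touchS; first exact: subsetIl.
exact/setSD/subsetUr.
Qed.

Definition component Z Y := [/\ conn Y, Y \subset Z & ~~ touch Y (Z :\: Y)].

(** A smallest nonempty part of [A] with no edge to the rest of [A] is connected; as [A] has no edge
    to the rest of [Z], neither has that part. *)
Lemma component_within Z (A : {set G}) : A != set0 -> A \subset Z -> ~~ touch A (Z :\: A) ->
  exists2 Y : {set G}, Y \subset A & component Z Y.
Proof.
have [n] := ubnP #|A|; elim: n A => // n IH A /ltnSE leA A0 sA nA.
pose bad B := [&& B != set0, B \subset A, B != A & ~~ touch B (A :\: B)].
have [/existsP[B /and4P[B0 sB neB nB]]|/existsPn good] := boolP [exists B, bad B].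
  have [||||Y sY cY] := IH B; rewrite ?(subset_trans sB) //.
  - by apply: leq_trans leA; apply: proper_card; rewrite properEneq neB.
  - apply: contra nB => /touchP[x [y [xB]]]; rewrite inE => /andP[nyB yZ] xy.
    apply/touchP; exists x, y; rewrite !inE nyB; split=> //.
    apply: contraR nA => nyA; apply/touchP; exists x, y; rewrite !inE nyA.
    by split=> //; apply: subsetP xB.
  - by exists Y => //; apply: subset_trans sB.
exists A => //; split=> //; split=> // B B0 sB neB.
by have := good B; rewrite /bad B0 sB neB /= negbK.
Qed.

Lemma component_exists Z : Z != set0 -> exists Y, component Z Y.
Proof.
move=> Z0; have [||Y] := @component_within Z Z Z0; rewrite ?subxx //.
  by apply/negP => /touchP[x [y [_]]]; rewrite setDv inE.
by exists Y.
Qed.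
End ConnectedSets.

Definition K23_minor_free (G : sgraph) :=
  forall (X Y : {set G}) (P : 'I_3 -> {set G}),
    conn X -> conn Y -> (forall i, conn (P i)) ->
    [disjoint X & Y] -> (forall i, [disjoint X & P i]) -> (forall i, [disjoint Y & P i]) ->
    (forall i j, i != j -> [disjoint P i & P j]) ->
    (forall i, touch X (P i)) -> (forall i, touch Y (P i)) -> False.

Lemma component_containing (G : sgraph) (Z : {set G}) (w : G) :
  w \in Z -> exists2 Y, component Z Y & w \in Y.
Proof.
have [n] := ubnP #|Z|; elim: n Z => // n IH Z /ltnSE leZ wZ.
have [|Y [cY sY nY]] := @component_exists G Z; first by apply/set0Pn; exists w.
have [wY|nwY] := boolP (w \in Y); first by exists Y.
have /set0Pn[y yY] := cY.1.
have [||Y' [cY' sY' nY'] wY'] := IH (Z :\: Y).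
- apply: leq_trans leZ; apply: proper_card; apply/properP; split; first exact: subsetDl.
  by exists y; rewrite ?inE ?yY // (subsetP sY).
- by rewrite inE nwY.
exists Y' => //; split=> //; first exact: subset_trans sY' (subsetDl _ _).
apply/negP => /touchP[a [b [aY']]]; rewrite inE => /andP[nbY' bZ] ab.
have [bY|nbY] := boolP (b \in Y).
  apply/negP: nY; rewrite negbK; apply/touchP; exists b, a.
  by rewrite (subsetP sY') // adj_sym.
by apply/negP: nY'; rewrite negbK; apply/touchP; exists a, b; rewrite !inE nbY' nbY.
Qed.

Lemma K23_minor_contra (G : sgraph) (X Y P1 P2 P3 : {set G}) : K23_minor_free G ->
  [/\ conn X, conn Y, conn P1, conn P2 & conn P3] ->
  [&& [disjoint X & Y], [disjoint P1 & P2], [disjoint P1 & P3] & [disjoint P2 & P3]] ->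
  [&& [disjoint X & P1], [disjoint X & P2] & [disjoint X & P3]] ->
  [&& [disjoint Y & P1], [disjoint Y & P2] & [disjoint Y & P3]] ->
  [&& touch X P1, touch X P2 & touch X P3] ->
  [&& touch Y P1, touch Y P2 & touch Y P3] -> False.
Proof.
move=> kf [cX cY c1 c2 c3] /and4P[XY d12 d13 d23] /and3P[X1 X2 X3] /and3P[Y1 Y2 Y3].
move=> /and3P[tX1 tX2 tX3] /and3P[tY1 tY2 tY3].
pose P (i : 'I_3) := match val i with 0 => P1 | 1 => P2 | _ => P3 end.
apply: (kf X Y P) => //; try by case=> [[|[|[|]]]].
move=> [[|[|[|//]]] ?] [[|[|[|//]]] ?]; rewrite -val_eqE //= /P /= => _ //;
  by rewrite disjoint_sym.
Qed.

(** * Pendant faces *)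

Section EndFace.
Variables (G : sgraph) (S : {set G}).
Hypothesis triangleF : forall x y z : G, adj x y -> adj y z -> adj z x -> False.
Hypothesis minorF : K23_minor_free G.

Definition nbs (v : G) := [set u in S | adj v u].

Hypothesis min_deg2 : forall v, v \in S -> 1 < #|nbs v|.

Implicit Types (W Z U Q : {set G}) (u v x y z w : G).

(* W is cut off from the rest of G[S] by a vertex or by an edge. *)
Definition attached W x y :=
  [/\ conn W, W \subset S, [&& x \in S, y \in S, x \notin W & y \notin W],
      (x == y) || adj x y &
      forall w u, w \in W -> u \in S -> adj w u -> [|| u \in W, u == x | u == y]].

(** Any component of [G[S]] minus a vertex [s] will do, with [x = y = s]. *)
Lemma attached_exists : S != set0 -> exists W x y, attached W x y.
Proof.
case/set0Pn => s sS.
have [u] : exists u, u \in nbs s.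
  by apply/set0Pn; rewrite -card_gt0 ltnW // min_deg2.
rewrite inE => /andP[uS su].
have [|W [cW sW nW]] := @component_exists G (S :\ s).
  by apply/set0Pn; exists u; rewrite !inE uS andbT; apply: contraTneq su => ->; rewrite adj_irrefl.
have nsW : s \notin W by apply/negP => /(subsetP sW); rewrite !inE eqxx.
exists W, s, s; rewrite /attached eqxx sS nsW; split=> //.
  by apply: subset_trans sW _; rewrite subsetDl.
move=> w v wW vS wv; rewrite orbb; case: eqVneq => [|vs]; rewrite ?orbT // orbF.
apply: contraR nW => nvW; apply/touchP; exists w, v.
by rewrite !inE nvW vs.
Qed.

Section Minimal.
Variables (W : {set G}) (x y : G).
Hypothesis attW : attached W x y.
Hypothesis minW : forall W' x' y', attached W' x' y' -> #|W| <= #|W'|.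

Lemma attached_proper W' x' y' : W' \proper W -> ~ attached W' x' y'.
Proof. by move=> /proper_card + /minW; rewrite ltnNge => /negP. Qed.

Lemma component_touch Z Q z : conn Z -> z \in Z -> component (Z :\ z) Q -> touch [set z] Q.
Proof.
move=> [_ cZ] zZ [cQ sQ nQ].
have /touchP[a [b [aQ]]] : touch Q (Z :\: Q).
  apply: cZ; first by case: cQ.
    exact: subset_trans sQ (subsetDl _ _).
  by apply: contraTneq zZ => <-; apply/negP => /(subsetP sQ); rewrite !inE eqxx.
rewrite inE => /andP[nbQ bZ] ab; apply/touchP; exists b, a; rewrite adj_sym inE.
split=> //; apply: contraR nQ => bz; apply/touchP; exists a, b.
by rewrite !inE nbQ bz.
Qed.

Lemma component_nb Z Q z w u : component (Z :\ z) Q -> w \in Q -> adj w u -> u \in Z ->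
  (u \in Q) || (u == z).
Proof.
move=> [_ _ nQ] wQ wu uZ; apply: contraR nQ; rewrite negb_or => /andP[nuQ uz].
by apply/touchP; exists w, u; rewrite !inE nuQ uz.
Qed.

(** How minimality of [W] is exploited: [Q] would be attached at the edge [sz], and it misses [z],
    so it would be smaller than [W]. *)
Lemma component_attached Z Q z s : Z \subset W -> z \in Z -> component (Z :\ z) Q ->
  s \in S -> s \notin Z -> adj s z ->
  (forall w u, w \in Q -> u \in S -> adj w u -> [|| u \in Z, u == z | u == s]) -> False.
Proof.
move=> sZ zZ /[dup] compQ [cQ sQ nQ] sS nsZ sz nbQ.
have sQZ : Q \subset Z by apply: subset_trans sQ (subsetDl _ _).
have [_ sW _ _ _] := attW.
have zQ : z \notin Q by apply/negP => /(subsetP sQ); rewrite !inE eqxx.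
apply: (@attached_proper Q s z); last split=> //.
- apply/properP; split; first exact: subset_trans sZ.
  by exists z => //; apply: (subsetP sZ).
- by apply: subset_trans sQZ (subset_trans sZ sW).
- rewrite sS zQ (subsetP sW) ?(subsetP sZ) //= andbT.
  by apply: contra nsZ => /(subsetP sQZ).
- by rewrite sz orbT.
move=> w u wQ uS wu; case/or3P: (nbQ w u wQ uS wu) => [uZ|->|->]; rewrite ?orbT //.
by case/orP: (component_nb compQ wQ wu uZ) => ->; rewrite ?orbT.
Qed.

(** The minimal [W] hangs on a genuine edge. If [s] has a neighbour [w] in [W], a component of [W]
    minus [w] is attached at the edge [sw]; otherwise it is attached at [w] alone. Either way it is
    smaller than [W]. *)
Lemma not_attached1 s : ~ attached W s s.
Proof.
move=> [cW sW /and4P[sS _ nsW _] _ nbW].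
have rest w : w \in W -> W :\ w != set0.
  move=> wW; have : 0 < #|nbs w :\ s|.
    have := min_deg2 (subsetP sW w wW); rewrite (cardsD1 s).
    by case: (s \in _); rewrite ?add0n // => /ltnW.
  case/card_gt0P => u; rewrite !inE => /and3P[us uS wu].
  have := nbW w u wW uS wu; rewrite (negbTE us) !orbF => uW.
  apply/set0Pn; exists u; rewrite !inE uW andbT.
  by apply: contraTneq wu => ->; rewrite adj_irrefl.
have [/touchP[s' [w [+ wW sw]]]|nsW'] := boolP (touch [set s] W).
  rewrite inE => /eqP ss'; rewrite {s'}ss' in sw.
  have [Q compQ] := component_exists (rest w wW).
  apply: (component_attached (subxx W) wW compQ sS nsW sw) => v u vQ uS vu.
  have [_ sQ _] := compQ; have vW : v \in W.
    by apply: (subsetP (subset_trans sQ (subsetDl _ _))).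
  by case/or3P: (nbW v u vW uS vu) => ->; rewrite ?orbT.
have /set0Pn[w wW] := cW.1.
have [Q /[dup] compQ [cQ sQ nQ]] := component_exists (rest w wW).
have sQW : Q \subset W by apply: subset_trans sQ (subsetDl _ _).
have wQ : w \notin Q by apply/negP => /(subsetP sQ); rewrite !inE eqxx.
apply: (@attached_proper Q w w); last split=> //.
- by apply/properP; split=> //; exists w.
- exact: subset_trans sW.
- by rewrite wQ (subsetP sW).
- by rewrite eqxx.
move=> v u vQ uS vu; rewrite orbb; apply: (component_nb compQ vQ vu).
have vW := subsetP sQW v vQ.
case/or3P: (nbW v u vW uS vu) => // /eqP us; case/negP: nsW'.
  by apply/touchP; exists s, v; rewrite inE -us adj_sym.
by apply/touchP; exists s, v; rewrite inE -us adj_sym.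
Qed.

(* Invariant of the walk from x through W towards y: the vertices already
   visited, together with x, form U and end in u; those left form Z. *)
Definition frontier u Z U :=
  [/\ [/\ conn Z, conn U, touch [set u] Z & touch U [set y]],
      [/\ Z \subset W, u \in U, u \in S & y \notin U],
      [disjoint U & Z] &
      forall w v, w \in Z -> v \in S -> adj w v -> [|| v \in Z, v == u | v == y]].

(** A component of [Z] minus [z] that misses [y] would be attached at the edge [uz]. Two components
    reaching [y] would form, together with [U], the side of three of a K_{2,3} whose other side is
    [z], [y]. *)
Lemma frontier_remainder u Z U z : frontier u Z U -> z \in Z -> adj u z -> Z :\ z != set0 ->
  conn (Z :\ z) /\ touch (Z :\ z) [set y].
Proof.
move=> [[cZ cU tuZ tUy] [sZ uU uS yU] dUZ nbZ] zZ uz Z0.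
have [_ sW /and4P[_ yS _ yW] _ _] := attW.
have nuZ : u \notin Z by rewrite (disjointFr dUZ).
have nyZ : y \notin Z by apply: contra yW => /(subsetP sZ).
have touch_y Q : component (Z :\ z) Q -> touch Q [set y].
  move=> compQ; apply: contraT => nQy; exfalso.
  apply: (component_attached sZ zZ compQ uS nuZ uz) => w v wQ vS wv.
  have [_ sQ _] := compQ; have wZ : w \in Z.
    by apply: (subsetP (subset_trans sQ (subsetDl _ _))).
  case/or3P: (nbZ w v wZ vS wv) => [->|->|/eqP vy]; rewrite ?orbT //.
  by case/negP: nQy; apply/touchP; exists w, y; rewrite inE -vy.
have [Q /[dup] compQ [cQ sQ nQ]] := component_exists Z0.
suff QZ : Q = Z :\ z by rewrite -QZ; split=> //; apply: touch_y.
apply/eqP; rewrite eqEsubset sQ; apply: contraT => nsQ; exfalso.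
have [|||Q' sQ' /[dup] compQ' [cQ' _ _]] := @component_within G (Z :\ z) ((Z :\ z) :\: Q).
- by rewrite setD_eq0.
- exact: subsetDl.
- rewrite setDDr setDv set0U (setIidPr sQ) touchC //.
have dQQ' : [disjoint Q & Q'].
  rewrite disjoint_sym disjoints_subset; apply: subset_trans sQ' _.
  by apply/subsetP => v; rewrite !inE => /andP[].
have inZ Q0 : component (Z :\ z) Q0 -> (Q0 \subset Z) && (z \notin Q0).
  move=> [_ sQ0 _]; rewrite (subset_trans sQ0 (subsetDl _ _)).
  by apply/negP => /(subsetP sQ0); rewrite !inE eqxx.
have /andP[sQZ zQ] := inZ Q compQ; have /andP[sQ'Z zQ'] := inZ Q' compQ'.
have zU : z \notin U by rewrite (disjointFl dUZ).
apply: (@K23_minor_contra G [set z] [set y] Q Q' U minorF).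
- by split=> //; apply: conn1.
- rewrite disjoints1 inE dQQ' !(disjoint_sym _ U) !(disjointWr _ dUZ) // !andbT.
  by apply: contraNneq nyZ => <-.
- by rewrite !disjoints1 zQ zQ' zU.
- rewrite !disjoints1 yU; apply/and3P; split=> //.
    by apply: contra nyZ => /(subsetP sQZ).
  by apply: contra nyZ => /(subsetP sQ'Z).
- rewrite (component_touch cZ zZ compQ) (component_touch cZ zZ compQ') /=.
  by apply/touchP; exists z, u; rewrite inE adj_sym.
- by rewrite ![touch [set y] _]touchC tUy !touch_y.
Qed.

(** Two neighbours [z], [z'] of [u] in [Z] lead to a K_{2,3} minor. Which one depends on whether [y]
    has a neighbour in [Z] other than these two. *)
Lemma frontier_unique u Z U z z' : frontier u Z U -> z \in Z -> z' \in Z ->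
  adj u z -> adj u z' -> z = z'.
Proof.
move=> fr zZ z'Z uz uz'; apply/eqP; apply: contraT => zz'; exfalso.
have [[cZ cU tuZ tUy] [sZ uU uS yU] dUZ nbZ] := fr.
have [_ sW /and4P[_ yS _ yW] _ _] := attW.
have nuZ : u \notin Z by rewrite (disjointFr dUZ).
have nyZ : y \notin Z by apply: contra yW => /(subsetP sZ).
have uy : u != y by apply: contraNneq yU => <-.
have [cZz tZz] : conn (Z :\ z) /\ touch (Z :\ z) [set y].
  by apply: (frontier_remainder fr) => //; apply/set0Pn; exists z'; rewrite !inE eq_sym zz'.
have [cZz' tZz'] : conn (Z :\ z') /\ touch (Z :\ z') [set y].
  by apply: (frontier_remainder fr) => //; apply/set0Pn; exists z; rewrite !inE zz'.
have nzz' : ~~ adj z z'.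
  by apply/negP => zz; apply: (triangleF uz zz); rewrite adj_sym.
pose M := Z :\ z :\ z'.
have ME : M = Z :\ z' :\ z by apply/setP => v; rewrite !inE andbCA.
have comp_facts Q : component M Q -> [/\ touch [set z] Q, touch [set z'] Q,
    Q \subset Z & (z \notin Q) && (z' \notin Q)].
  move=> compQ; have [_ sQ _] := compQ.
  have z'Zz : z' \in Z :\ z by rewrite !inE eq_sym zz'.
  have zZz' : z \in Z :\ z' by rewrite !inE zz'.
  split; last by apply/andP; split; apply/negP => /(subsetP sQ); rewrite !inE !eqxx ?andbF.
  - by apply: (component_touch cZz' zZz'); rewrite -ME.
  - exact: (component_touch cZz z'Zz).
  - by apply: subset_trans sQ _; apply/subsetP => v; rewrite !inE => /and3P[].
(* If it has one, in a component [Q] of [M], the sides are [U], [Q] and [z], [z'], [y]. *)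
have [/existsP[w /andP[wM wy]]|/existsPn nwy] := boolP [exists w, (w \in M) && adj w y].
  have [Q /[dup] compQ [cQ _ _] wQ] := component_containing wM.
  have [tzQ tz'Q sQ /andP[zQ z'Q]] := comp_facts Q compQ.
  apply: (@K23_minor_contra G U Q [set z] [set z'] [set y] minorF).
  - by split=> //; apply: conn1.
  - rewrite !disjoints1 !inE zz' (disjointWr sQ dUZ) /=.
    by apply/andP; split; apply: contraNneq nyZ => <-.
  - rewrite ![[disjoint U & _]]disjoint_sym !disjoints1 yU.
    by rewrite (disjointFl dUZ zZ) (disjointFl dUZ z'Z).
  - rewrite ![[disjoint Q & _]]disjoint_sym !disjoints1 zQ z'Q /=.
    by apply: contra nyZ => /(subsetP sQ).
  - rewrite tUy andbT; apply/andP; split; apply/touchP.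
      by exists u, z; rewrite inE.
    by exists u, z'; rewrite inE.
  - rewrite touchC tzQ touchC tz'Q /=; apply/touchP; exists w, y.
    by rewrite inE.
(* Now no vertex of [M] is adjacent to [y], so [z] and [z'] both are, and the sides are [z], [z']
   and [y], [u], a component of [M]. *)
have yz' : adj z' y.
  have /touchP[a [b [aZ]]] := tZz; rewrite inE => /eqP-> ay.
  suff <- : a = z' by [].
  by apply/eqP; apply: contraT => az'; have := nwy a; rewrite !inE az' ay andbT -in_setD1 aZ.
have yz : adj z y.
  have /touchP[a [b [aZ]]] := tZz'; rewrite inE => /eqP-> ay.
  suff <- : a = z by [].
  apply/eqP; apply: contraT => az; have := nwy a; rewrite ME !inE az ay andbT /=.
  by rewrite -in_setD1 aZ.
(* If [M] were empty, connectedness of [Z] would force the edge [zz'], which closes a triangle with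
   [u]. *)
have M0 : M != set0.
  apply: contraNneq nzz' => M0; have [_ /(_ [set z])] := cZ.
  have ZE : Z :\ z = [set z'].
    apply/setP => v; move/setP/(_ v): M0; rewrite !inE.
    by case: eqVneq => [->|] /=; rewrite ?z'Z ?andbT // eq_sym.
  rewrite ZE => tz; have /touchP[a [b []]] : touch [set z] [set z'].
    apply: tz; rewrite ?sub1set //; first by apply/set0Pn; exists z; rewrite inE.
    by apply: contraTneq z'Z => <-; rewrite inE eq_sym.
  by rewrite !inE => /eqP-> /eqP->.
have [Q /[dup] compQ [cQ _ _]] := component_exists M0.
have [tzQ tz'Q sQ /andP[zQ z'Q]] := comp_facts Q compQ.
apply: (@K23_minor_contra G [set z] [set z'] [set y] Q [set u] minorF).
- by split=> //; apply: conn1.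
- rewrite [[disjoint Q & _]]disjoint_sym !disjoints1 !inE zz' (eq_sym y) uy /=.
  by apply/andP; split; apply/negP => /(subsetP sQ); apply/negP.
- rewrite !disjoints1 !inE zQ /=; apply/andP; split.
    by apply: contraNneq nyZ => <-.
  by apply: contraNneq nuZ => <-.
- rewrite !disjoints1 !inE z'Q /=; apply/andP; split.
    by apply: contraNneq nyZ => <-.
  by apply: contraNneq nuZ => <-.
- rewrite tzQ /=; apply/andP; split; apply/touchP; [exists z, y|exists z, u].
    by rewrite !inE.
  by rewrite !inE adj_sym.
- rewrite tz'Q /=; apply/andP; split; apply/touchP; [exists z', y|exists z', u].
    by rewrite !inE.
  by rewrite !inE adj_sym.
Qed.

(** By [frontier_unique], [z] is the only way from [u] into [Z], so the vertices beyond [z] see only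
    [z] and [y] outside. If some are left and [z] is adjacent to [y], they are attached at the edge
    [zy], against minimality. *)
Lemma frontier_step u Z U : frontier u Z U ->
  exists z, [/\ z \in Z, adj u z &
    (Z = [set z] /\ nbs z = [set u; y]) \/
    (frontier z (Z :\ z) (U :|: [set z]) /\ ~~ adj z y)].
Proof.
move=> fr; have [[cZ cU tuZ tUy] [sZ uU uS yU] dUZ nbZ] := fr.
have [_ sW /and4P[_ yS _ yW] _ _] := attW.
have nyZ : y \notin Z by apply: contra yW => /(subsetP sZ).
have uy : u != y by apply: contraNneq yU => <-.
have /touchP[u' [z [+ zZ uz]]] := tuZ; rewrite inE => /eqP eu; rewrite {u'}eu in uz.
have zS : z \in S by apply/(subsetP sW)/(subsetP sZ).
exists z; split=> //; have [Z0|Z0] := eqVneq (Z :\ z) set0.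
  left; have ZE : Z = [set z] by apply/eqP; rewrite eqEsubset sub1set zZ -setD_eq0 Z0 eqxx.
  split=> //; apply/eqP; rewrite eqEcard cards2 uy min_deg2 // andbT.
  apply/subsetP => v; rewrite !inE => /andP[vS zv].
  have := nbZ z v zZ vS zv; rewrite {1}ZE inE; case: eqVneq => // vz.
  by move: zv; rewrite vz adj_irrefl.
right; have [cZz tZz] := frontier_remainder fr zZ uz Z0.
have nb' w v : w \in Z :\ z -> v \in S -> adj w v -> [|| v \in Z :\ z, v == z | v == y].
  rewrite inE => /andP[]; rewrite inE => wz wZ vS wv; rewrite !inE.
  case/or3P: (nbZ w v wZ vS wv) => [->|/eqP vu|->]; rewrite ?orbT ?andbT //.
    by case: eqVneq.
  case/eqP: wz; apply: (frontier_unique fr) => //.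
  by rewrite -vu adj_sym.
split; last first.
  apply/negP => zy; apply: (@attached_proper (Z :\ z) z y).
    by apply: proper_sub_trans sZ; apply: properD1.
  split=> //.
  - by apply: subset_trans (subsetDl _ _) (subset_trans sZ sW).
  - by rewrite zS yS !inE eqxx (negbTE nyZ) andbF.
  - by rewrite zy orbT.
have zU : z \notin U by rewrite (disjointFl dUZ).
split; [split=> //|split=> //| |done].
- by apply: connU => //; [apply: conn1|apply/touchP; exists u, z; rewrite inE].
- have [_ /(_ [set z])] := cZ; apply; rewrite ?sub1set //.
    by apply/set0Pn; exists z; rewrite inE.
  by apply: contraNneq Z0 => <-; rewrite setDv.
- by apply: touchS tUy; rewrite ?subxx ?subsetUl.
- exact: subset_trans (subsetDl _ _) sZ.
- by rewrite !inE eqxx orbT.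
- by rewrite !inE negb_or yU; apply: contraNneq nyZ => ->.
rewrite -setI_eq0 setIUl; apply/eqP/setP => v; rewrite !inE.
have [vU|nvU] := boolP (v \in U); first by rewrite (disjointFr dUZ vU) !andbF.
by case: eqVneq.
Qed.

(** [frontier_unique] at the next frontier leaves a single neighbour ahead of [z], and the only one
    behind is [u]. *)
Lemma frontier_degree u Z U z z' : frontier u Z U -> z \in Z -> adj u z -> ~~ adj z y ->
  frontier z (Z :\ z) (U :|: [set z]) -> z' \in Z :\ z -> adj z z' -> nbs z = [set u; z'].
Proof.
move=> fr zZ uz nzy fr' z'Z zz'.
have [_ [sZ _ uS _] dUZ nbZ] := fr; have [_ sW _ _ _] := attW.
apply/setP => v; rewrite !inE; apply/andP/orP => [[vS zv]|[]/eqP->].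
- case/or3P: (nbZ z v zZ vS zv) => [vZ|->|/eqP vy]; [right|by left|].
    apply/eqP; apply: (frontier_unique fr') => //; rewrite !inE vZ andbT.
    by apply: contraTneq zv => ->; rewrite adj_irrefl.
  by rewrite -vy zv in nzy.
- by rewrite adj_sym uS.
- by split=> //; apply/(subsetP sW)/(subsetP sZ); move: z'Z; rewrite !inE => /andP[].
Qed.

(** [not_attached1] excludes [x = y]. It also gives [x] a neighbour in [W], since otherwise [W]
    would be attached at [y] alone. *)
Lemma frontier_start : frontier x W [set x] /\ adj x y.
Proof.
have [cW sW /and4P[xS yS xW yW] xy nbW] := attW.
have neq : x != y by apply/eqP => exy; apply: (@not_attached1 x); rewrite {2}exy.
rewrite (negbTE neq) /= in xy; split=> //; split; [split=> //|split=> //| |done].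
- exact: conn1.
- apply: contraT => nt; case: (@not_attached1 y); split=> //; rewrite ?yS ?yW ?eqxx //.
  move=> w u wW uS wu; case/or3P: (nbW w u wW uS wu) => [->|/eqP ux|->]; rewrite ?orbT //.
  by case/negP: nt; apply/touchP; exists x, w; rewrite inE -ux adj_sym.
- by apply/touchP; exists x, y; rewrite !inE.
- by rewrite inE.
- by rewrite inE eq_sym.
- by rewrite disjoints1.
Qed.

End Minimal.

(** The walk from [x] to [y] follows the boundary of the pendant face, and its inner vertices have
    degree 2. One inner vertex would close a triangle and two close a 4-cycle; if there are more,
    the first three are taken. *)
Theorem end_face : S != set0 ->
  (exists x u v y, [/\ uniq [:: x; u; v; y], all (mem S) [:: x; u; v; y], adj x y,
     nbs u = [set x; v] & nbs v = [set u; y]]) \/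
  (exists x u v w t, [/\ uniq [:: x; u; v; w; t], all (mem S) [:: x; u; v; w; t],
     nbs u = [set x; v], nbs v = [set u; w] & nbs w = [set v; t]]).
Proof.
move=> S0.
have [W [x [y [attW minW]]]] : exists W x y, attached W x y /\
    forall W' x' y', attached W' x' y' -> #|W| <= #|W'|.
  pose P n := `[< exists W x y, attached W x y /\ #|W| = n >].
  have exP : exists n, P n.
    by have [W [x [y att]]] := attached_exists S0; exists #|W|; apply/asboolP; exists W, x, y.
  have [n /asboolP[W [x [y [att cW]]]] min_n] := ex_minnP exP.
  exists W, x, y; split=> // W' x' y' att'; rewrite cW; apply: min_n.
  by apply/asboolP; exists W', x', y'.
have [_ sW /and4P[xS yS xW yW] _ _] := attW.
have inW v : v \in W -> [/\ v \in S, v != x & v != y].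
  move=> vW; rewrite (subsetP sW) //; split=> //.
    by apply: contraNneq xW => <-.
  by apply: contraNneq yW => <-.
have [fr0 xy] := frontier_start attW minW.
have xyne : x != y by apply: contraTneq xy => ->; rewrite adj_irrefl.
have [u [uW xu [[_ nbu]|[fr1 nuy]]]] := frontier_step attW minW fr0.
  have uy : adj u y.
    have : y \in nbs u by rewrite nbu !inE eqxx orbT.
    by rewrite inE => /andP[].
  by case: (triangleF xu uy); rewrite adj_sym.
have [uS ux uy] := inW u uW.
have [v [vZ uv step2]] := frontier_step attW minW fr1.
have nbu := frontier_degree attW minW fr0 uW xu nuy fr1 vZ uv.
have [vu vW] : v != u /\ v \in W by move: vZ; rewrite !inE => /andP.
have [vS vx vy] := inW v vW.
case: step2 => [[_ nbv]|[fr2 nvy]].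
  left; exists x, u, v, y; split=> //=; last by rewrite xS uS vS yS.
  by rewrite !inE !negb_or /= (eq_sym x u) ux (eq_sym x v) vx xyne (eq_sym u v) vu uy vy.
have [w [wZ vw step3]] := frontier_step attW minW fr2.
have nbv := frontier_degree attW minW fr1 vZ uv nvy fr2 wZ vw.
have [wv wu wW] : [/\ w != v, w != u & w \in W] by move: wZ; rewrite !inE => /and3P[].
have [wS wx wy] := inW w wW.
(* The fifth vertex is [y] if the walk ends at [w], and otherwise the next vertex of the walk. *)
right; case: step3 => [[_ nbw]|[fr3 nwy]].
  exists x, u, v, w, y; split=> //=; last by rewrite xS uS vS wS yS.
  rewrite !inE !negb_or /= (eq_sym x u) ux (eq_sym x v) vx (eq_sym x w) wx xyne.
  by rewrite (eq_sym u v) vu (eq_sym u w) wu uy (eq_sym v w) wv vy wy.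
have [t [tZ wt _]] := frontier_step attW minW fr3.
have nbw := frontier_degree attW minW fr2 wZ vw nwy fr3 tZ wt.
have [tw tv tu tW] : [/\ t != w, t != v, t != u & t \in W].
  by move: tZ; rewrite !inE => /and4P[].
have [tS tx ty] := inW t tW.
exists x, u, v, w, t; split=> //=; last by rewrite xS uS vS wS tS.
rewrite !inE !negb_or /= (eq_sym x u) ux (eq_sym x v) vx (eq_sym x w) wx (eq_sym x t) tx.
by rewrite (eq_sym u v) vu (eq_sym u w) wu (eq_sym u t) tu (eq_sym v w) wv
  (eq_sym v t) tv (eq_sym w t) tw.
Qed.
End EndFace.

(** * Extending colourings *)

Section Colouring.
Variables (G : sgraph) (D : nat).
Implicit Types (S N : {set G}) (f g : G -> 'I_D.+3).

Definition valid S f g :=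
  [/\ forall v, v \in S -> f v != g v,
      forall u v, u \in S -> v \in S -> adj u v ->
        [&& f u != f v, g u != g v & f u != g v] &
      forall u v w, u \in S -> v \in S -> w \in S -> adj u v -> adj v w -> u != w ->
        f u != f w].

(** The danger in putting [N] back is a new pair of old vertices at distance 2 with its middle in
    [N]. The hypothesis that a vertex of [N] has at most one neighbour in the rest of [S] rules this
    out, and all other new constraints involve a vertex of [N]. *)
Lemma valid_extend S N f g f' g' :
  valid (S :\: N) f g ->
  (forall v, v \notin N -> f' v = f v /\ g' v = g v) ->
  (forall n u w, n \in N -> u \in S :\: N -> w \in S :\: N -> adj n u -> adj n w -> u = w) ->
  (forall n, n \in N -> f' n != g' n) ->
  (forall n w, n \in N -> w \in S -> adj n w ->
     [&& f' n != f' w, g' n != g' w, f' n != g' w & g' n != f' w]) ->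
  (forall n m w, n \in N -> m \in S -> w \in S -> adj n m -> adj m w -> n != w ->
     f' n != f' w) ->
  valid S f' g'.
Proof.
move=> [v1 v2 v3] agree one e1 e2 e3.
have old v : v \in S -> v \notin N -> v \in S :\: N by rewrite inE => -> ->.
split=> [v vS|u v uS vS uv|u v w uS vS wS uv vw uw].
- have [/e1//|nvN] := boolP (v \in N).
  by have [-> ->] := agree v nvN; apply/v1/old.
- have [uN|nuN] := boolP (u \in N); first by have /and4P[-> -> ->] := e2 u v uN vS uv.
  have [vN|nvN] := boolP (v \in N).
    rewrite adj_sym in uv; have /and4P[? ? ? ?] := e2 v u vN uS uv.
    by apply/and3P; split; rewrite eq_sym.
  by have [-> ->] := agree u nuN; have [-> ->] := agree v nvN; apply: v2 => //; apply: old.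
have [uN|nuN] := boolP (u \in N); first exact: (e3 u v w).
have [wN|nwN] := boolP (w \in N).
  by rewrite eq_sym; apply: (e3 w v u); rewrite // 1?adj_sym // 1?eq_sym.
have [vN|nvN] := boolP (v \in N).
  case/eqP: uw; apply: (one v) => //; rewrite ?old //.
  by rewrite adj_sym.
have [-> _] := agree u nuN; have [-> _] := agree w nwN.
by apply: (v3 u v w); rewrite ?old.
Qed.

Lemma fresh_colour k (s : seq 'I_k) : size s < k -> exists c, c \notin s.
Proof.
move=> sk; apply/existsP; apply: contraTT sk => /existsPn sP.
rewrite -leqNgt -{1}(card_ord k); apply: leq_trans (card_size s).
by apply/subset_leq_card/subsetP => c _; have := sP c; rewrite negbK.
Qed.

Hypothesis deg_le : forall v : G, #|neighbours v| <= D.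

Lemma nbs_le S v : #|nbs S v| <= D.
Proof.
apply: leq_trans (deg_le v); apply/subset_leq_card/subsetP => u.
by rewrite !inE => /andP[].
Qed.

Lemma adj_nbs S v w (A : {set G}) : nbs S v = A -> w \in S -> adj v w -> w \in A.
Proof. by move=> <- wS vw; rewrite inE wS. Qed.

Lemma nbs_adj S v w (A : {set G}) : nbs S v = A -> w \in A -> adj v w.
Proof. by move=> <-; rewrite inE => /andP[]. Qed.

(** The colours that a coloured neighbour [x] forbids for [f u]. As [u] is itself a neighbour of
    [x], there are at most [2 + (D - 1)] of them. *)
Definition around S (f g : G -> 'I_D.+3) x u :=
  f x :: g x :: [seq f z | z in nbs S x :\ u].

Lemma size_around S f g x u : u \in S -> adj u x -> size (around S f g x u) <= D.+1.
Proof.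
move=> uS ux; rewrite /= size_image !ltnS.
have uN : u \in nbs S x by rewrite inE uS adj_sym.
by have := nbs_le S x; rewrite (cardsD1 u) uN; case: #|_ :\ _| => // n; rewrite ltnS => /ltnW.
Qed.

Lemma aroundP S f g x u c : c \notin around S f g x u ->
  [/\ c != f x, c != g x & forall z, z \in nbs S x -> z != u -> c != f z].
Proof.
rewrite !inE !negb_or => /and3P[-> -> nc]; split=> // z zx zu.
by apply: contraNneq nc => ->; apply: image_f; rewrite !inE zu; move: zx; rewrite inE.
Qed.

Lemma valid_low_degree S v f g : v \in S -> #|nbs S v| <= 1 ->
  valid (S :\ v) f g -> exists f' g', valid S f' g'.
Proof.
move=> vS dv val.
have [nb0|] := eqVneq (nbs S v) set0.
  have nonb w : w \in S -> adj v w -> False by move=> /(adj_nbs nb0) /[apply]; rewrite inE.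
  (* An isolated [v] keeps the value that [f] happens to have there; only [g v] is chosen. *)
  have [c] := @fresh_colour _ [:: f v] isT; rewrite inE => cf.
  exists f, [eta g with v |-> c]; apply: (valid_extend val).
  - by move=> w; rewrite inE /= => /negbTE->.
  - by move=> n u w; rewrite inE => /eqP->; rewrite inE => /andP[_ /nonb H] _ /H.
  - by move=> n; rewrite inE => /eqP->; rewrite /= eqxx eq_sym.
  - by move=> n w; rewrite inE => /eqP-> /nonb /[apply].
  - by move=> n m w; rewrite inE => /eqP-> /nonb H _ /H.
case/set0Pn => x xv.
have nbv : nbs S v = [set x].
  by apply/esym/eqP; rewrite eqEcard sub1set xv cards1.
have xS : x \in S by move: xv; rewrite inE => /andP[].
have vx : adj v x by apply: (nbs_adj nbv); rewrite inE.
have nxv : x != v by apply: contraTneq vx => ->; rewrite adj_irrefl.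
have [c cP] : exists c, c \notin around S f g x v.
  by apply: fresh_colour; rewrite (leq_ltn_trans (size_around f g vS vx)).
have [cfx cgx cz] := aroundP cP.
have D_gt0 : 0 < D by apply: leq_trans (nbs_le S v); rewrite nbv cards1.
have [d] : exists d, d \notin [:: g x; f x; c] by apply: fresh_colour; rewrite /= !ltnS.
rewrite !inE !negb_or => /and3P[dgx dfx dc].
exists [eta f with v |-> c], [eta g with v |-> d]; apply: (valid_extend val).
- by move=> w; rewrite inE /= => /negbTE->.
- move=> n u w; rewrite inE => /eqP->; rewrite !inE => /andP[_ uS] /andP[_ wS].
  move=> /(adj_nbs nbv uS) + /(adj_nbs nbv wS).
  by rewrite !inE => /eqP-> /eqP->.
- by move=> n; rewrite inE => /eqP->; rewrite /= eqxx eq_sym.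
- move=> n w; rewrite inE => /eqP-> wS /(adj_nbs nbv wS); rewrite inE => /eqP->.
  by rewrite /= eqxx (negbTE nxv) cfx dgx cgx dfx.
- move=> n m w; rewrite inE => /eqP-> mS wS /(adj_nbs nbv mS); rewrite inE => /eqP-> xw vw.
  rewrite /= eqxx [w == v]eq_sym (negbTE vw); apply: cz; last by rewrite eq_sym.
  by rewrite inE wS.
Qed.

Lemma valid_square S x u v y f g : 2 < D ->
  uniq [:: x; u; v; y] -> all (mem S) [:: x; u; v; y] -> adj x y ->
  nbs S u = [set x; v] -> nbs S v = [set u; y] ->
  valid (S :\: [set u; v]) f g -> exists f' g', valid S f' g'.
Proof.
move=> D_gt2 /=; rewrite !inE !negb_or => /and4P[/and3P[xu xv xy'] /andP[uv uy] vy _].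
case/and5P=> xS uS vS yS _ xy nbu nbv val.
have ux : adj u x by apply: (nbs_adj nbu); rewrite !inE eqxx.
have vy' : adj v y by apply: (nbs_adj nbv); rewrite !inE eqxx orbT.
have [cu cuP] : exists c, c \notin around S f g x u.
  by apply: fresh_colour; rewrite (leq_ltn_trans (size_around f g uS ux)).
have [cv] : exists c, c \notin cu :: around S f g y v.
  by apply: fresh_colour; rewrite ltnS (leq_ltn_trans (size_around f g vS vy')).
rewrite in_cons negb_or => /andP[cvu cvP].
have [cux cugx cuz] := aroundP cuP; have [cvy cvgy cvz] := aroundP cvP.
have [du] : exists c, c \notin [:: g x; f x; cu; cv] by apply: fresh_colour; rewrite /= !ltnS ltnW.
rewrite !inE !negb_or => /and4P[dugx dufx ducu ducv].
(* Five excluded colours: the place where [2 < D] is used in full. *)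
have [dv] : exists c, c \notin [:: g y; f y; cu; cv; du] by apply: fresh_colour; rewrite /= !ltnS.
rewrite !inE !negb_or => /and5P[dvgy dvfy dvcu dvcv dvdu].
(* The edge [xy] enters here: [y] is one of the vertices around [x], and [x] one of those around
   [y]. *)
have cuy : cu != f y by apply: cuz; rewrite ?inE ?yS // eq_sym.
have cvx : cv != f x by apply: cvz; rewrite ?inE ?xS // adj_sym.
pose f' := [eta f with u |-> cu, v |-> cv]; pose g' := [eta g with u |-> du, v |-> dv].
have fu : f' u = cu by rewrite /= eqxx.
have gu : g' u = du by rewrite /= eqxx.
have fv : f' v = cv by rewrite /= eq_sym (negbTE uv) eqxx.
have gv : g' v = dv by rewrite /= eq_sym (negbTE uv) eqxx.
have old z : z != u -> z != v -> f' z = f z /\ g' z = g z by rewrite /= => /negbTE-> /negbTE->.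
have [fx gx] := old x xu xv; have [fy gy] : f' y = f y /\ g' y = g y.
  by apply: old; rewrite eq_sym.
exists f', g'; apply: (valid_extend val); rewrite -/f' -/g'.
- by move=> z; rewrite !inE negb_or => /andP[/old]; apply.
- move=> n a b; rewrite !inE => /orP[]/eqP-> /andP[+ aS] /andP[+ bS];
    rewrite !negb_or => /andP[au av] /andP[bu bv].
    move=> /(adj_nbs nbu aS) + /(adj_nbs nbu bS).
    by rewrite !inE (negbTE av) (negbTE bv) !orbF => /eqP-> /eqP->.
  move=> /(adj_nbs nbv aS) + /(adj_nbs nbv bS).
  by rewrite !inE (negbTE au) (negbTE bu) /= => /eqP-> /eqP->.
- by move=> n; rewrite !inE => /orP[]/eqP->; rewrite ?fu ?gu ?fv ?gv eq_sym.
- move=> n w; rewrite !inE => /orP[]/eqP-> wS.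
    move=> /(adj_nbs nbu wS); rewrite !inE => /orP[]/eqP->; rewrite ?(fu, gu, fv, gv, fx, gx).
      by rewrite cux dugx cugx.
    by rewrite ![cu == _]eq_sym (eq_sym du) cvu dvdu dvcu.
  move=> /(adj_nbs nbv wS); rewrite !inE => /orP[]/eqP->; rewrite ?(fu, gu, fv, gv, fy, gy).
    by rewrite cvu dvdu (eq_sym cv) ducv dvcu.
  by rewrite cvy dvgy cvgy.
- move=> n m w; rewrite !inE => /orP[]/eqP-> mS wS.
    move=> /(adj_nbs nbu mS); rewrite !inE => /orP[]/eqP-> mw uw.
      have wv : w != v.
        apply: contraTneq mw => ->; rewrite adj_sym; apply/negP => /(adj_nbs nbv xS).
        by rewrite !inE (negbTE xu) (negbTE xy').
      rewrite eq_sym in uw; have [-> _] := old w uw wv; rewrite fu; apply: cuz => //.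
      by rewrite inE wS.
    move: (adj_nbs nbv wS mw) uw; rewrite !inE => /orP[]/eqP->; rewrite ?eqxx // => _.
    by rewrite fu fy.
  move=> /(adj_nbs nbv mS); rewrite !inE => /orP[]/eqP-> mw vw.
    move: (adj_nbs nbu wS mw) vw; rewrite !inE => /orP[]/eqP->; rewrite ?eqxx // => _.
    by rewrite fv fx.
  have wu : w != u.
    apply: contraTneq mw => ->; rewrite adj_sym; apply/negP => /(adj_nbs nbu yS).
    by rewrite !inE [y == x]eq_sym [y == v]eq_sym (negbTE xy') (negbTE vy).
  rewrite eq_sym in vw; have [-> _] := old w wu vw; rewrite fv; apply: cvz => //.
  by rewrite inE wS.
Qed.

(** [f u] and [f w] are bound by opposite ends of the path and otherwise only have to differ from
    each other; [f v], chosen after them, sees just [x], [u], [w], [t]. *)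
Lemma valid_three_path S x u v w t f g : 2 < D ->
  uniq [:: x; u; v; w; t] -> all (mem S) [:: x; u; v; w; t] ->
  nbs S u = [set x; v] -> nbs S v = [set u; w] -> nbs S w = [set v; t] ->
  valid (S :\: [set u; v; w]) f g -> exists f' g', valid S f' g'.
Proof.
move=> D_gt2 /=; rewrite !inE !negb_or.
case/and5P=> /and4P[xu xv xw xt] /and3P[uv uw ut] /andP[vw vt] wt _.
case/and5P=> xS uS vS wS /andP[tS _] nbu nbv nbw val.
have ux : adj u x by apply: (nbs_adj nbu); rewrite !inE eqxx.
have wt' : adj w t by apply: (nbs_adj nbw); rewrite !inE eqxx orbT.
have [cu cuP] : exists c, c \notin around S f g x u.
  by apply: fresh_colour; rewrite (leq_ltn_trans (size_around f g uS ux)).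
have [cw] : exists c, c \notin cu :: around S f g t w.
  by apply: fresh_colour; rewrite ltnS (leq_ltn_trans (size_around f g wS wt')).
rewrite in_cons negb_or => /andP[cwu cwP].
have [cux cugx cuz] := aroundP cuP; have [cwt cwgt cwz] := aroundP cwP.
have [cv] : exists c, c \notin [:: f x; f t; cu; cw] by apply: fresh_colour; rewrite /= !ltnS ltnW.
rewrite !inE !negb_or => /and4P[cvx cvt cvu cvw].
have [du] : exists c, c \notin [:: g x; f x; cu; cv] by apply: fresh_colour; rewrite /= !ltnS ltnW.
rewrite !inE !negb_or => /and4P[dugx dufx ducu ducv].
have [dw] : exists c, c \notin [:: g t; f t; cw; cv] by apply: fresh_colour; rewrite /= !ltnS ltnW.
rewrite !inE !negb_or => /and4P[dwgt dwft dwcw dwcv].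
have [dv] : exists c, c \notin [:: du; dw; cu; cv; cw] by apply: fresh_colour; rewrite /= !ltnS.
rewrite !inE !negb_or => /and5P[dvdu dvdw dvcu dvcv dvcw].
pose f' := [eta f with u |-> cu, v |-> cv, w |-> cw].
pose g' := [eta g with u |-> du, v |-> dv, w |-> dw].
have fu : f' u = cu by rewrite /= eqxx.
have gu : g' u = du by rewrite /= eqxx.
have fv : f' v = cv by rewrite /= eq_sym (negbTE uv) eqxx.
have gv : g' v = dv by rewrite /= eq_sym (negbTE uv) eqxx.
have fw : f' w = cw by rewrite /= ![w == _]eq_sym (negbTE uw) (negbTE vw) eqxx.
have gw : g' w = dw by rewrite /= ![w == _]eq_sym (negbTE uw) (negbTE vw) eqxx.
have old z : z != u -> z != v -> z != w -> f' z = f z /\ g' z = g z.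
  by rewrite /= => /negbTE-> /negbTE-> /negbTE->.
have [fx gx] := old x xu xv xw; have [ft gt] : f' t = f t /\ g' t = g t.
  by apply: old; rewrite eq_sym.
exists f', g'; apply: (valid_extend val); rewrite -/f' -/g'.
- by move=> z; rewrite !inE !negb_or => /andP[/andP[/old H /H]]; apply.
- move=> n a b; rewrite !inE => /orP[/orP[]|]/eqP-> /andP[+ aS] /andP[+ bS];
    rewrite !negb_or => /andP[/andP[au av] aw] /andP[/andP[bu bv] bw].
  + move=> /(adj_nbs nbu aS) + /(adj_nbs nbu bS).
    by rewrite !inE (negbTE av) (negbTE bv) !orbF => /eqP-> /eqP->.
  + move=> /(adj_nbs nbv aS) + /(adj_nbs nbv bS).
    by rewrite !inE (negbTE au) (negbTE aw).
  + move=> /(adj_nbs nbw aS) + /(adj_nbs nbw bS).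
    by rewrite !inE (negbTE av) (negbTE bv) /= => /eqP-> /eqP->.
- by move=> n; rewrite !inE => /orP[/orP[]|]/eqP->; rewrite ?fu ?gu ?fv ?gv ?fw ?gw eq_sym.
- move=> n z; rewrite !inE => /orP[/orP[]|]/eqP-> zS.
  + move=> /(adj_nbs nbu zS); rewrite !inE => /orP[]/eqP->; rewrite ?(fu, gu, fv, gv, fx, gx).
      by rewrite cux dugx cugx.
    by rewrite ![cu == _]eq_sym (eq_sym du) cvu dvdu dvcu.
  + move=> /(adj_nbs nbv zS); rewrite !inE => /orP[]/eqP->; rewrite ?(fu, gu, fv, gv, fw, gw).
      by rewrite cvu dvdu (eq_sym cv) ducv dvcu.
    by rewrite cvw dvdw (eq_sym cv) dwcv dvcw.
  + move=> /(adj_nbs nbw zS); rewrite !inE => /orP[]/eqP->; rewrite ?(fv, gv, fw, gw, ft, gt).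
      by rewrite ![cw == _]eq_sym (eq_sym dw) cvw dvdw dvcw.
    by rewrite cwt dwgt cwgt.
- move=> n m z; rewrite !inE => /orP[/orP[]|]/eqP-> mS zS.
  + move=> /(adj_nbs nbu mS); rewrite !inE => /orP[]/eqP-> mz uz.
      have zv : z != v.
        apply: contraTneq mz => ->; rewrite adj_sym; apply/negP => /(adj_nbs nbv xS).
        by rewrite !inE (negbTE xu) (negbTE xw).
      have zw : z != w.
        apply: contraTneq mz => ->; rewrite adj_sym; apply/negP => /(adj_nbs nbw xS).
        by rewrite !inE (negbTE xv) (negbTE xt).
      rewrite eq_sym in uz; have [-> _] := old z uz zv zw; rewrite fu; apply: cuz => //.
      by rewrite inE zS.
    move: (adj_nbs nbv zS mz) uz; rewrite !inE => /orP[]/eqP->; rewrite ?eqxx // => _.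
    by rewrite fu fw eq_sym.
  + move=> /(adj_nbs nbv mS); rewrite !inE => /orP[]/eqP-> mz vz.
      move: (adj_nbs nbu zS mz) vz; rewrite !inE => /orP[]/eqP->; rewrite ?eqxx // => _.
      by rewrite fv fx.
    move: (adj_nbs nbw zS mz) vz; rewrite !inE => /orP[]/eqP->; rewrite ?eqxx // => _.
    by rewrite fv ft.
  + move=> /(adj_nbs nbw mS); rewrite !inE => /orP[]/eqP-> mz wz.
      move: (adj_nbs nbv zS mz) wz; rewrite !inE => /orP[]/eqP->; rewrite ?eqxx // => _.
      by rewrite fu fw.
    have zv : z != v.
      apply: contraTneq mz => ->; rewrite adj_sym; apply/negP => /(adj_nbs nbv tS).
      by rewrite !inE ![t == _]eq_sym (negbTE ut) (negbTE wt).
    have zu : z != u.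
      apply: contraTneq mz => ->; rewrite adj_sym; apply/negP => /(adj_nbs nbu tS).
      by rewrite !inE ![t == _]eq_sym (negbTE xt) (negbTE vt).
    rewrite eq_sym in wz; have [-> _] := old z zu zv wz; rewrite fw; apply: cwz => //.
    by rewrite inE zS.
Qed.
End Colouring.

(** * Cycles and periodic words *)

Lemma min_degree2_cycle (G : sgraph) (S : {set G}) : S != set0 ->
  (forall v, v \in S -> 1 < #|nbs S v|) ->
  exists c : seq G, [/\ ucycle (@adj G) c, 2 < size c & all (mem S) c].
Proof.
case/set0Pn => s sS deg2.
suff long n x (p : seq G) : #|G| - size p < n -> uniq (x :: p) -> path (@adj G) x p ->
    all (mem S) (x :: p) ->
    exists c : seq G, [/\ ucycle (@adj G) c, 2 < size c & all (mem S) c].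
  by apply: (long _ s [::] (ltnSn _)); rewrite //= sS.
elim: n x p => // n IH x p /ltnSE le_n Up xp /= /andP[xS pS].
have [/existsP[w /andP[]]|/existsPn all_in] := boolP [exists w, (w \in nbs S x) && (w \notin p)].
  rewrite inE => /andP[wS xw] wp.
  have wx : w != x by apply: contraTneq xw => ->; rewrite adj_irrefl.
  have Uwxp : uniq [:: w, x & p] by rewrite /= inE negb_or wx wp.
  apply: (IH w (x :: p)) => //=; rewrite ?wS ?xS //; last by rewrite adj_sym xw.
  apply: leq_trans le_n; apply: ltn_sub2l => //.
  have := max_card (mem [:: w, x & p]); rewrite (card_uniqP Uwxp) /=; exact: leq_trans.
(* All neighbours of the head [x] lie on the path. One that is not the successor of [x] closes a
   cycle with at least three vertices. *)
have [z zx zp] : exists2 z, z \in nbs S x & z != head x p.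
  have : 0 < #|nbs S x :\ head x p|.
    have := deg2 x xS; rewrite (cardsD1 (head x p)).
    by case: (_ \in _) => //; rewrite add0n => /ltnW.
  by case/card_gt0P => z; rewrite !inE => /andP[zp zx]; exists z; rewrite ?inE.
have zinp : z \in p by have := all_in z; rewrite zx negbK.
move: zx; rewrite inE => /andP[zS xz].
case/splitPr: zinp zp Up xp pS => p1 p2 zp Up xp pS.
exists (x :: rcons p1 z); split.
- move: xp Up; rewrite -cat_rcons cat_path => /andP[xp _].
  rewrite -cat_cons cat_uniq => /andP[Uc _]; rewrite /ucycle Uc andbT /= rcons_path xp.
  by rewrite last_rcons adj_sym.
- by case: p1 zp {Up xp pS} => [|a p1] /=; rewrite ?eqxx // size_rcons.
- by move: pS; rewrite all_cat /= all_rcons => /andP[-> _]; rewrite /= xS zS.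
Qed.

Lemma next_next_neq (T : eqType) (c : seq T) v : uniq c -> 2 < size c -> v \in c ->
  next c (next c v) != v.
Proof.
move=> Uc sc /rot_to[i p cE]; rewrite -!(next_rot i Uc) cE.
have := size_rot i c; have := rot_uniq i c; rewrite cE Uc.
case: p {cE} => [|a [|b p]] /= U sz; rewrite -?sz // in sc *.
move: U; rewrite /= !inE !negb_or => /and3P[/and3P[va vb _] /andP[ab _] _].
by rewrite /= !eqxx [a == v]eq_sym (negbTE va) /= ?eqxx eq_sym.
Qed.

Lemma index_next (T : eqType) (c : seq T) v : uniq c -> v \in c ->
  index (next c v) c = if (index v c).+1 < size c then (index v c).+1 else 0.
Proof.
case: c => // x p Uc vc; rewrite next_nth vc -[nth _ _ _]/(nth x (x :: p) (index v (x :: p)).+1).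
case: ltnP => lt; first by rewrite index_uniq.
by rewrite nth_default // index_head.
Qed.

(* A letter is the pair (f v, g v) at a vertex v of a cycle. *)
Definition letter_ok (a b d : nat * nat) :=
  [&& a.1 < 5, a.2 < 5, a.1 != a.2, a.1 != b.1 & [&& a.2 != b.2, a.1 != b.2, a.2 != b.1 & a.1 != d.1]].

Fixpoint word_ok (l : seq (nat * nat)) :=
  if l is a :: l' then (if l' is b :: d :: _ then letter_ok a b d else true) && word_ok l'
  else true.

Lemma word_okP x0 l i : word_ok l -> i.+2 < size l ->
  letter_ok (nth x0 l i) (nth x0 l i.+1) (nth x0 l i.+2).
Proof.
elim: l i => // a l IH [|i] /= /andP[ok okl]; last by rewrite ltnS => /(IH i okl).
by case: l ok {IH okl} => [|b [|d l]].
Qed.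

(** All words start with the same two letters and stay legal when these are appended, that is, when
    read cyclically. Hence the four-letter word may be put in front of any of them, and lengths 4 to
    7 suffice as base. *)
Lemma cyclic_word n : 3 < n -> exists l,
  size l = n /\ word_ok (l ++ [:: (0, 4); (1, 2)]) /\ take 2 l = [:: (0, 4); (1, 2)].
Proof.
have [m] := ubnP n; elim: m n => // m IH n nm n_gt3.
have [n_lt8|n_ge8] := ltnP n 8; last first.
  have [||l [sl [okl tl]]] := IH (n - 4).
  - by lia.
  - by lia.
  case: l tl sl okl => [|a [|b l]] //= [-> ->] sl okl.
  exists [:: (0, 4), (1, 2), (3, 0), (2, 1), (0, 4), (1, 2) & l]; split=> //=; lia.
case: n n_gt3 n_lt8 {nm IH} => [|[|[|[|[|[|[|[|n]]]]]]]] // _ _.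
- by exists [:: (0, 4); (1, 2); (3, 0); (2, 1)].
- by exists [:: (0, 4); (1, 2); (3, 0); (4, 1); (2, 3)].
- by exists [:: (0, 4); (1, 2); (3, 0); (2, 1); (4, 0); (3, 1)].
- by exists [:: (0, 4); (1, 2); (3, 0); (2, 1); (0, 3); (1, 4); (2, 3)].
Qed.

Lemma cycle_letters (T : eqType) (c : seq T) : uniq c -> 3 < size c ->
  exists col : T -> nat * nat, forall v, v \in c ->
    letter_ok (col v) (col (next c v)) (col (next c (next c v))).
Proof.
move=> Uc sc; have [l [sl [okl tl]]] := cyclic_word sc.
pose a : nat * nat := (0, 4); pose b : nat * nat := (1, 2).
(* [E] continues [l] by its own first two letters, so that reading past the end of [l] means reading
   around the cycle. *)
pose E := l ++ [:: a; b]; exists (fun v => nth a l (index v c)) => v vc.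
have n_gt1 : 1 < size c by rewrite ltnW // ltnW.
have lE i : i < size c -> nth a l i = nth a E i by move=> ic; rewrite /E nth_cat sl ic.
have l0 : nth a l 0 = a by case: (l) tl => [|? [|? ?]] //= [->].
have l1 : nth a l 1 = b by case: (l) tl => [|? [|? ?]] //= [_ ->].
have En : nth a E (size c) = a by rewrite /E nth_cat sl ltnn subnn.
have En1 : nth a E (size c).+1 = b by rewrite /E nth_cat sl ltnNge leqnSn subSnn.
have vlt : index v c < size c by rewrite index_mem.
have next_col w : w \in c -> nth a l (index (next c w) c) = nth a E (index w c).+1.
  move=> wc; rewrite index_next //; case: ltnP => lt; first exact: lE.
  rewrite l0; suff -> : (index w c).+1 = size c by rewrite En.
  by apply/eqP; rewrite eqn_leq lt index_mem wc.
have -> : nth a l (index (next c (next c v)) c) = nth a E (index v c).+2.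
  rewrite next_col ?mem_next // index_next //; case: ltnP => // lt.
  have ->: (index v c).+1 = size c by apply/eqP; rewrite eqn_leq lt vlt.
  by rewrite En1 -lE.
rewrite next_col // lE //; apply: word_okP okl _.
by rewrite size_cat sl addn2 !ltnS.
Qed.

Section CycleColouring.
Variables (G : sgraph) (D : nat).

(** With degrees at most 2 in [G[S]] the cycle has no edge to the rest of [S], so its colouring is
    independent of the given one. *)
Lemma valid_cycle (S : {set G}) c (f g : G -> 'I_D.+3) : 1 < D ->
  ucycle (@adj G) c -> 3 < size c -> all (mem S) c ->
  (forall v, v \in c -> #|nbs S v| <= 2) ->
  valid (S :\: [set v in c]) f g -> exists f' g' : G -> 'I_D.+3, valid S f' g'.
Proof.
move=> D_gt1 /andP[cyc Uc] sc /allP cS deg ok_rest.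
have [col colP] := cycle_letters Uc sc.
have nbc v : v \in c -> nbs S v = [set next c v; prev c v].
  move=> vc; have nS : next c v \in S by apply: cS; rewrite mem_next.
  have pS : prev c v \in S by apply: cS; rewrite mem_prev.
  have np : next c v != prev c v.
    apply: contraNneq (next_next_neq Uc (ltnW sc) vc) => ->.
    by rewrite next_prev.
  apply/esym/eqP; rewrite eqEcard cards2 np deg // andbT subUset !sub1set !inE nS pS.
  by rewrite (next_cycle cyc vc) adj_sym (prev_cycle cyc vc).
(* Since [1 < D] there are at least five colours, so [inord] is injective on the numbers occurring
   in letters. *)
pose h (k : nat) : 'I_D.+3 := inord k.
have hne i j : i < 5 -> j < 5 -> i != j -> h i != h j.
  move=> i5 j5; apply: contraNneq => /(congr1 (@nat_of_ord _)); rewrite !inordK => [->||] //;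
  by apply: leq_trans (_ : 5 <= _).
pose f' v := if v \in c then h (col v).1 else f v.
pose g' v := if v \in c then h (col v).2 else g v.
have bound v : v \in c -> (col v).1 < 5 /\ (col v).2 < 5.
  by move=> /colP /and5P[-> ->].
have next_ok v : v \in c -> [&& f' v != f' (next c v), g' v != g' (next c v),
    f' v != g' (next c v) & g' v != f' (next c v)].
  move=> vc; rewrite /f' /g' mem_next vc.
  have [b1 b2] := bound v vc; have [|b3 b4] := bound (next c v); first by rewrite mem_next.
  have /and5P[_ _ _ ? /and4P[? ? ? ?]] := colP v vc.
  by rewrite !hne.
have next2_ok v : v \in c -> f' v != f' (next c (next c v)).
  move=> vc; rewrite /f' !mem_next vc.
  have [b1 b2] := bound v vc; have [|b3 b4] := bound (next c (next c v)); first by rewrite !mem_next.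
  by have /and5P[_ _ _ ? /and4P[? ? ? ?]] := colP v vc; rewrite hne.
exists f', g'; apply: (valid_extend ok_rest).
- by move=> v; rewrite inE /f' /g' => /negbTE->.
- move=> n u w; rewrite !inE => nc /andP[uc uS] _ /(adj_nbs (nbc n nc) uS).
  by rewrite !inE => /orP[]/eqP e; move: uc; rewrite e ?mem_next ?mem_prev nc.
- move=> n; rewrite inE /f' /g' => nc; rewrite nc; have [b1 b2] := bound n nc.
  by have /and5P[_ _ ? _ _] := colP n nc; rewrite hne.
- move=> n w; rewrite inE => nc wS /(adj_nbs (nbc n nc) wS); rewrite !inE => /orP[]/eqP->.
    exact: next_ok.
  have := next_ok (prev c n); rewrite mem_prev next_prev // => /(_ nc) /and4P[? ? ? ?].
  by apply/and4P; split; rewrite eq_sym.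
- move=> n m w; rewrite inE => nc mS wS /(adj_nbs (nbc n nc) mS).
  have pc : prev c n \in c by rewrite mem_prev.
  have nxc : next c n \in c by rewrite mem_next.
  rewrite !inE => /orP[]/eqP-> mw; [have := adj_nbs (nbc _ nxc) wS mw|have := adj_nbs (nbc _ pc) wS mw];
    rewrite !inE => /orP[]/eqP->; rewrite ?prev_next ?next_prev ?eqxx // => _.
    exact: next2_ok.
  rewrite eq_sym; have := next2_ok (prev c (prev c n)); rewrite !mem_prev !next_prev //.
  exact.
Qed.
End CycleColouring.

Theorem valid_exists (G : sgraph) (S : {set G}) :
  triangle_free G -> K23_minor_free G ->
  exists f g : G -> 'I_(max_degree G).+3, valid S f g.
Proof.
move=> tfG mfG; set D := max_degree G.
have deg_le (v : G) : #|neighbours v| <= D by apply: (leq_bigmax v).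
have triF (x y z : G) : adj x y -> adj y z -> adj z x -> False.
  move=> xy yz zx; apply: tfG; exists [:: x; y; z]; split=> //.
  rewrite /ucycle /= xy yz zx !inE negb_or !andbT /=.
  have ne (a b : G) : adj a b -> a != b by apply: contraTneq => ->; rewrite adj_irrefl.
  by rewrite (ne x y) // (ne y z) // eq_sym (ne z x).
have [n] := ubnP #|S|; elim: n S => // n IH S /ltnSE leS.
have [->|S0] := eqVneq S set0.
  by exists (fun=> ord0), (fun=> ord0); split=> [v|u v|u v w]; rewrite inE.
have smaller (N : {set G}) v : v \in N -> v \in S ->
    exists f g : G -> 'I_D.+3, valid (S :\: N) f g.
  move=> vN vS; apply: IH; apply: leq_trans leS; apply: proper_card; apply/properP.
  by split; [exact: subsetDl|exists v; rewrite // inE vN].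
have [/existsP[v /andP[vS dv]]|/existsPn deg2] := boolP [exists v, (v \in S) && (#|nbs S v| <= 1)].
  have [|f [g val]] := smaller [set v] v _ vS; first by rewrite inE.
  exact: (valid_low_degree deg_le vS dv val).
have {}deg2 v : v \in S -> 1 < #|nbs S v| by move=> vS; have := deg2 v; rewrite vS -ltnNge.
have D_gt1 : 1 < D.
  by case/set0Pn: (S0) => v /deg2 /leq_trans; apply; apply: nbs_le.
have [D_le2|D_gt2] := leqP D 2.
  have [c [cyc sc cS]] := min_degree2_cycle S0 deg2.
  (* Triangle-freeness provides the length four from which cyclic words exist. *)
  have sc3 : 3 < size c.
    by rewrite ltn_neqAle sc andbT eq_sym; apply/eqP => s3; apply: tfG; exists c.
  have [v vc] : exists v, v \in c by case: c sc {cyc cS sc3} => // v c; exists v; rewrite inE eqxx.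
  have [||f [g val]] := smaller [set v in c] v; rewrite ?inE //; first exact: (allP cS).
  apply: (valid_cycle D_gt1 cyc sc3 cS _ val) => w _.
  exact: leq_trans (nbs_le deg_le S w) D_le2.
have [[x [u [v [y [U A xy nbu nbv]]]]]|[x [u [v [w [t [U A nbu nbv nbw]]]]]]] :=
  end_face triF mfG deg2 S0.
- have uS : u \in S by move: A => /= /and3P[].
  have [|f [g val]] := smaller [set u; v] u _ uS; first by rewrite !inE eqxx.
  exact: (valid_square deg_le D_gt2 U A xy nbu nbv val).
- have uS : u \in S by move: A => /= /and3P[].
  have [|f [g val]] := smaller [set u; v; w] u _ uS; first by rewrite !inE eqxx.
  exact: (valid_three_path deg_le D_gt2 U A nbu nbv nbw val).
Qed.

(** * From pairs of vertex colourings to incidence colourings *)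

Section IncidenceColouring.
Variables (G : sgraph) (k : nat) (f g : G -> 'I_k.+3).

(** The default value is never taken, since every edge has a second vertex. *)
Definition other_end (i : incidence G) : G :=
  odflt (inc_vertex i) [pick u in inc_edge i :\ inc_vertex i].

Lemma other_endP (i : incidence G) :
  adj (inc_vertex i) (other_end i) /\ inc_edge i = [set inc_vertex i; other_end i].
Proof.
have := valP i; rewrite -/(inc_edge i) -/(inc_vertex i) inE.
case/andP=> /existsP[a /existsP[b /andP[ab /eqP iE]]] vi.
have ba : b != a by apply: contraTneq ab => ->; rewrite adj_irrefl.
rewrite /other_end; move: vi; rewrite iE !inE => vi.
case: pickP => [u|none] /=.
  rewrite !inE; case/orP: vi => /eqP->.
    by case/andP=> /negbTE-> /= /eqP->.
  by case/andP=> /negbTE->; rewrite orbF => /eqP->; rewrite adj_sym ab setUC.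
case/orP: vi => /eqP vi; [have := none b|have := none a]; rewrite !inE vi eqxx ?orbT ?andbT.
  by rewrite ba.
by rewrite eq_sym ba.
Qed.

Lemma other_end_uniq (i : incidence G) u : inc_edge i = [set inc_vertex i; u] ->
  u != inc_vertex i -> other_end i = u.
Proof.
move=> iE ui; have [io iE'] := other_endP i.
have : u \in inc_edge i by rewrite iE !inE eqxx orbT.
by rewrite iE' !inE (negbTE ui) => /eqP.
Qed.

Lemma opposite_ends (i j : incidence G) : inc_edge i = inc_edge j ->
  inc_vertex i != inc_vertex j -> inc_vertex j = other_end i /\ other_end j = inc_vertex i.
Proof.
move=> eij vij; have [_ iE] := other_endP i; have [_ jE] := other_endP j.
have jo : inc_vertex j = other_end i.
  have : inc_vertex j \in inc_edge i by rewrite eij jE !inE eqxx.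
  by rewrite iE !inE eq_sym (negbTE vij) => /eqP.
split=> //; apply: other_end_uniq => //.
by rewrite -eij iE jo setUC.
Qed.

Lemma incidence_inj (i j : incidence G) : inc_vertex i = inc_vertex j ->
  other_end i = other_end j -> i = j.
Proof.
move=> ev eo; apply: inc_eq => //.
by have [_ ->] := other_endP i; have [_ ->] := other_endP j; rewrite ev eo.
Qed.

(** [I2 v] consists of the incidences with other end [v], so one colour per [I2 v] means that the
    colour depends on the other end only. *)
Definition incidence_colour (x : vi_elt G) : 'I_k.+3 :=
  match x with inl v => g v | inr i => f (other_end i) end.

(** Walks of length at most 3 between distinct elements: two vertices are adjacent; a vertex and an
    incidence share an edge; two incidences have other ends that are adjacent, or distinct with a
    common neighbour. *)
Lemma incidence_colour_ok : valid [set: G] f g -> vi_coloring 1 incidence_colour.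
Proof.
case=> v1 v2 v3.
have fg v : f v != g v by apply: v1.
have ff u v : adj u v -> f u != f v by move=> /v2; rewrite !inE => /(_ isT isT) /and3P[].
have gg u v : adj u v -> g u != g v by move=> /v2; rewrite !inE => /(_ isT isT) /and3P[].
have fga u v : adj u v -> f u != g v by move=> /v2; rewrite !inE => /(_ isT isT) /and3P[].
have fff u v w : adj u v -> adj v w -> u != w -> f u != f w by apply: v3; rewrite inE.
have adjo i : adj (inc_vertex i) (other_end i) by have [] := other_endP i.
split=> [|v]; last first.
  apply: leq_trans (_ : #|[set f v]| <= 1); last by rewrite cards1.
  apply/subset_leq_card/subsetP => _ /imsetP[i + ->]; rewrite !inE /= => /andP[vi /eqP iE].
  rewrite (other_end_uniq iE) //.
  by apply: contraTneq vi => ->; rewrite adj_irrefl.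
have opp i j : third_adj (inr i) (inr j) -> inc_vertex j = other_end i /\ other_end j = inc_vertex i.
  by case/andP=> /eqP eij vij; apply: opposite_ends.
have colour_vi (u : G) (j : incidence G) : inc_vertex j = u \/ other_end j = u ->
    g u != f (other_end j).
  case=> <-; rewrite eq_sym; last exact: fg.
  by apply: fga; rewrite adj_sym.
have dist_vi (u : G) (j : incidence G) p : path (@third_adj G) (inl u) p -> last (inl u) p = inr j ->
    size p <= 3 -> inc_vertex j = u \/ other_end j = u.
  case: p => [|[w|i] [|a [|b [|? ?]]]] //=.
  - by rewrite andbT => /eqP <- [->] _; left.
  - case/and3P=> /eqP <- ia _ ej _; rewrite ej in ia.
    by have [_ ->] := opp _ _ ia; right.
  - case/and4P=> /eqP <- ia ab _ ej _; rewrite ej in ab; left.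
    case: a ia ab => [w|m] ia; first by move=> /eqP->; move/eqP: ia.
    have [mi oi] := opp _ _ ia; move=> mj; have [jo _] := opp _ _ mj.
    by rewrite jo oi.
move=> [u|i] [v|j] ne [p [pth lst sz]] /eqP; apply/negP => /=.
- case: p pth lst sz => [_ /= [uv]|[w|i] [|a [|b [|? ?]]]] //=.
  + by case: ne; rewrite uv.
  + case/and3P=> /eqP iu ia _ ea; rewrite ea /= in ia.
    by case: ne; rewrite -iu (eqP ia).
  + case/and4P=> /eqP iu ia ab _ eb _; rewrite eb in ab.
    case: a ia ab => [w|m] //= ia /eqP mv.
    have [mi oi] := opp _ _ ia; apply: gg.
    by rewrite -iu -mv mi.
- exact/colour_vi/(dist_vi _ _ _ pth lst sz).
- rewrite eq_sym; apply: colour_vi.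
  have rp := rev_path (@third_adj G) (inr i) p; rewrite lst in rp.
  apply: (dist_vi v i (rev (belast (inr i) p))).
  + by rewrite rp; apply: sub_path pth => a b; rewrite third_adj_sym.
  + case: p lst {pth sz rp ne} => [|a p] //= _.
    by rewrite rev_cons last_rcons.
  + by rewrite size_rev size_belast.
- case: p pth lst sz => [_ /= [ij]|a [|b [|d [|? ?]]]] //=.
  + by case: ne; rewrite ij.
  + rewrite andbT => ia ea _; rewrite ea in ia; have [_ ->] := opp _ _ ia.
    by apply: ff; rewrite adj_sym.
  + case/and3P=> ia ab _ eb _; rewrite eb in ab.
    case: a ia ab => [w|m] ia ab.
      apply: (fff _ w); first by rewrite adj_sym -(eqP ia).
        by rewrite -(eqP ab).
      apply/eqP => eo; case: ne; congr inr; apply: incidence_inj => //.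
      by rewrite (eqP ia) (eqP ab).
    have [mi oi] := opp _ _ ia; have [jm oj] := opp _ _ ab.
    by case: ne; congr inr; apply: incidence_inj; rewrite ?jm ?oj ?oi ?mi.
  + case/and4P=> ia ab bd _ ed _; rewrite ed in bd.
    case: a ia ab => [w|m] ia ab.
      case: b ab bd => [//|m] ab bd; have [_ ->] := opp _ _ bd.
      by apply: ff; rewrite adj_sym (eqP ab) -(eqP ia).
    have [mi oi] := opp _ _ ia.
    case: b ab bd => [w|m'] ab bd.
      by apply: ff; rewrite -mi (eqP ab) -(eqP bd).
    have [mi' oi'] := opp _ _ ab; have [_ ->] := opp _ _ bd.
    by apply: ff; rewrite mi' oi adj_sym.
Qed.
End IncidenceColouring.

(** * Crossing parity of K_{3,3} *)

Section CrossingParity.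
Local Open Scope ring_scope.
Variable R : realFieldType.
Implicit Types x y u v : R * R.

(** A half-open half-plane: for [x] nonzero it contains exactly one of [x] and [- x], so points on
    the axis need no general position. *)
Definition lex_pos x := (0 < x.2) || ((x.2 == 0) && (0 < x.1)).

(* Parity of the crossings of the segment [x, y] with the ray of positive
   abscissae, provided 0 is not on the segment. *)
Definition ray_cross x y :=
  (lex_pos x != lex_pos y) && ((0 < x.1 * y.2 - x.2 * y.1) == lex_pos y).

(** The four half-planes bounded by an axis: [h.1] selects the abscissa, [h.2] the positive side. *)
Definition half_plane (h : bool * bool) x :=
  let c := if h.1 then x.1 else x.2 in if h.2 then 0 < c else c < 0.

(** A potential for [ray_cross] on the half-plane [h]. Only the right half-plane meets the ray, and
    there a crossing is a change of [lex_pos]. *)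
Definition half_plane_sign h x := [&& h.1, h.2 & lex_pos x].

Lemma ray_cross_half_plane h x y : half_plane h x -> half_plane h y ->
  ray_cross x y = half_plane_sign h x (+) half_plane_sign h y.
Proof.
rewrite /half_plane /half_plane_sign /ray_cross /lex_pos.
case: h x y => [[] []] [x1 x2] [y1 y2] /= hx hy;
  case: (ltrgtP 0 x2) => hx2; case: (ltrgtP 0 y2) => hy2 //=;
  rewrite ?hx ?hy ?(lt_gtF hx) ?(lt_gtF hy) //=; try lra;
  try (by apply/eqP; nra); try (by apply/eqP/negbTE; rewrite -leNgt; nra).
Qed.

Lemma lex_posN h x : half_plane h x -> lex_pos (- x) = ~~ lex_pos x.
Proof.
rewrite /half_plane /lex_pos; case: h x => [[] []] [x1 x2] /= hx;
  rewrite ?oppr_gt0 ?oppr_eq0; case: (ltrgtP x2 0) => hx2 //=;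
  rewrite ?hx ?(lt_gtF hx) //; lra.
Qed.

Lemma half_planeN h x : half_plane h x -> half_plane (h.1, ~~ h.2) (- x).
Proof. by rewrite /half_plane; case: h x => [[] []] [x1 x2] /= hx; lra. Qed.

(** Negation exchanges the two rays of the horizontal axis, and a segment crosses the whole axis
    exactly when [lex_pos] changes. *)
Lemma ray_crossN h x y : half_plane h x -> half_plane h y ->
  ray_cross (- x) (- y) = ray_cross x y (+) (lex_pos x (+) lex_pos y).
Proof.
move=> hx hy; rewrite (ray_cross_half_plane hx hy).
rewrite (ray_cross_half_plane (half_planeN hx) (half_planeN hy)).
rewrite /half_plane_sign (lex_posN hx) (lex_posN hy) /=.
case: h hx hy => [[] []] /=; rewrite /half_plane /lex_pos => /=;
  try by case: (_ || _); case: (_ || _).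
- by move=> hx hy; rewrite hx hy.
- by move=> hx hy; rewrite !(lt_gtF hx, lt_gtF hy, lt_eqF hx, lt_eqF hy).
Qed.

(* Mod 2, the number of turns around v of the polygonal line q 0, ..., q n. *)
Definition turn v (q : nat -> R * R) n :=
  \big[addb/false]_(j < n) ray_cross (q j - v) (q j.+1 - v).

Lemma turn_rev v q n :
  (forall j, (j < n)%N -> exists h, half_plane h (q j - v) /\ half_plane h (q j.+1 - v)) ->
  \big[addb/false]_(j < n) ray_cross (v - q j) (v - q j.+1) =
  turn v q n (+) (lex_pos (q 0%N - v) (+) lex_pos (q n - v)).
Proof.
elim: n => [|n IH] hq; first by rewrite /turn !big_ord0 !addbb.
have [h [h1 h2]] := hq n (ltnSn n).
rewrite /turn !big_ord_recr /= IH => [|j jn]; last by apply/hq/ltnW.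
rewrite -(opprB (q n)) -(opprB (q n.+1)) (ray_crossN h1 h2) /turn.
move: (lex_pos _) (lex_pos _) (lex_pos _) (ray_cross _ _) (bigop _ _ _).
by do 5!case.
Qed.

(** The points [q j - p i] form a grid each of whose cells lies in a half-plane, so the crossings
    around a cell cancel. Summing the cells leaves the boundary of the grid: [q] seen from both ends
    of [p] and, after [turn_rev] at the price of the [lex_pos] terms, [p] seen from both ends of
    [q]. *)
Lemma turn_independent (p q : nat -> R * R) m n :
  (forall i j, (i < m)%N -> (j < n)%N -> exists h,
     [/\ half_plane h (q j - p i), half_plane h (q j.+1 - p i),
         half_plane h (q j - p i.+1) & half_plane h (q j.+1 - p i.+1)]) ->
  (0 < n)%N ->
  turn (p 0%N) q n (+) turn (p m) q n (+) turn (q 0%N) p m (+) turn (q n) p m =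
  lex_pos (p 0%N - q 0%N) (+) lex_pos (p m - q 0%N)
  (+) lex_pos (p 0%N - q n) (+) lex_pos (p m - q n).
Proof.
move=> H n_gt0.
have column i k : (i < m)%N -> (k <= n)%N ->
    turn (p i) q k (+) turn (p i.+1) q k =
    ray_cross (q 0%N - p i) (q 0%N - p i.+1) (+) ray_cross (q k - p i) (q k - p i.+1).
  move=> im; elim: k => [|k IH] kn; first by rewrite /turn !big_ord0 !addbb.
  move: (IH (ltnW kn)); rewrite /turn !big_ord_recr /=.
  have [h [h1 h2 h3 h4]] := H i k im kn.
  rewrite (ray_cross_half_plane h1 h2) (ray_cross_half_plane h3 h4).
  rewrite (ray_cross_half_plane h1 h3) (ray_cross_half_plane h2 h4).
  move: (ray_cross (q 0%N - p i) _) (bigop _ _ _) (bigop _ _ _).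
  by do 4!move: (half_plane_sign _ _); do 7!case.
have square k : (k <= m)%N -> turn (p 0%N) q n (+) turn (p k) q n =
    (\big[addb/false]_(i < k) ray_cross (q 0%N - p i) (q 0%N - p i.+1))
    (+) \big[addb/false]_(i < k) ray_cross (q n - p i) (q n - p i.+1).
  elim: k => [|k IH] km; first by rewrite !big_ord0 !addbb.
  rewrite !big_ord_recr /=; move: (IH (ltnW km)) (column k n km (leqnn n)).
  move: (ray_cross (q 0%N - p k) _) (ray_cross (q n - p k) _) (bigop _ _ _) (bigop _ _ _).
  by do 3!move: (turn _ _ _); do 7!case.
have rev0 := @turn_rev (q 0%N) p m; have revn := @turn_rev (q n) p m.
move: (square m (leqnn m)); rewrite rev0 ?revn.
- by do 4!move: (turn _ _ _); do 4!move: (lex_pos _); do 8!case.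
- case: n n_gt0 H {column square rev0 revn} => // n _ H j jm.
  have [h [_ h2 _ h4]] := H j n jm (ltnSn n); exists (h.1, ~~ h.2).
  by rewrite -!(opprB (q _)) !half_planeN.
- move=> j jm; have [h [h1 _ h3 _]] := H j 0%N jm n_gt0; exists (h.1, ~~ h.2).
  by rewrite -!(opprB (q _)) !half_planeN.
Qed.

Lemma common_half_plane (d : R) x y z w :
  d <= `|x.1| \/ d <= `|x.2| ->
  [/\ `|y.1 - x.1| < d, `|z.1 - x.1| < d & `|w.1 - x.1| < d] /\
  [/\ `|y.2 - x.2| < d, `|z.2 - x.2| < d & `|w.2 - x.2| < d] ->
  exists h, [/\ half_plane h x, half_plane h y, half_plane h z & half_plane h w].
Proof.
rewrite !ltr_norml => -[] dx [[/andP[? ?] /andP[? ?] /andP[? ?]]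
  [/andP[? ?] /andP[? ?] /andP[? ?]]]; move: dx.
- case: (lerP 0 x.1) => [/[dup] ? /ger0_norm->|/[dup] ? /ltr0_norm->] dx; [exists (true, true)|exists (true, false)];
    split; rewrite /half_plane /=; lra.
- case: (lerP 0 x.2) => [/[dup] ? /ger0_norm->|/[dup] ? /ltr0_norm->] dx; [exists (false, true)|exists (false, false)];
    split; rewrite /half_plane /=; lra.
Qed.

(** Every variable occurs an even number of times, so only the three negations remain. Case analysis
    on 22 Booleans is too large; the sum is computed in the ring of Booleans instead, [z] being half
    of it. *)
Lemma K33_parity (n01 n02 n10 n12 n20 n21 p0 p1 p2 q0 q1 q2
    r s0 s1 s2 t0 t1 t2 l01 l02 l12 : bool) :
  n01 (+) n02 (+) n10 (+) n12 (+) n20 (+) n21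
  (+) (p1 (+) q0 (+) n10 (+) (r (+) s0 (+) t1 (+) l01)
       (+) (p2 (+) q0 (+) n20 (+) (r (+) s0 (+) t2 (+) l02))
       (+) (p0 (+) q1 (+) n01 (+) (r (+) s1 (+) t0 (+) ~~ l01))
       (+) (p2 (+) q1 (+) n21 (+) (r (+) s1 (+) t2 (+) l12))
       (+) (p0 (+) q2 (+) n02 (+) (r (+) s2 (+) t0 (+) ~~ l02))
       (+) (p1 (+) q2 (+) n12 (+) (r (+) s2 (+) t1 (+) ~~ l12))) = true.
Proof.
rewrite -!addTb; change addb with (@GRing.add bool).
set z : bool := (n01 + n02 + n10 + n12 + n20 + n21 + p0 + p1 + p2 + q0 + q1 + q2
  + r + r + r + s0 + s1 + s2 + t0 + t1 + t2 + l01 + l02 + l12)%R.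
transitivity (z + z + (true + true + true))%R; first by rewrite /z; ring.
by rewrite [(z + z)%R]addbb.
Qed.

(* Summing [turn_independent] over the pairs of independent edges of K_{3,3},
   every [turn] occurs twice, while the right-hand sides add up to 1. *)
Theorem K33_chains_meet (d : R) (a b : 'I_3 -> R * R)
    (s : 'I_3 -> 'I_3 -> nat -> R * R) (n : 'I_3 -> 'I_3 -> nat) :
  (forall i j, s i j 0%N = a i) -> (forall i j, s i j (n i j) = b j) ->
  (forall i j, (0 < n i j)%N) ->
  (forall i j k, (k < n i j)%N ->
     `|(s i j k).1 - (s i j k.+1).1| < d / 2 /\
     `|(s i j k).2 - (s i j k.+1).2| < d / 2) ->
  (forall i j k l e f, i != k -> j != l -> (e <= n i j)%N -> (f <= n k l)%N ->
     d <= `|(s k l f).1 - (s i j e).1| \/ d <= `|(s k l f).2 - (s i j e).2|) ->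
  False.
Proof.
move=> s0 sn n_gt0 step far.
have E i j k l : i != k -> j != l ->
    turn (b j) (s k l) (n k l) = turn (a i) (s k l) (n k l)
    (+) turn (a k) (s i j) (n i j) (+) turn (b l) (s i j) (n i j)
    (+) (lex_pos (a i - a k) (+) lex_pos (b j - a k)
    (+) lex_pos (a i - b l) (+) lex_pos (b j - b l)).
  move=> ik jl.
  have := @turn_independent (s i j) (s k l) (n i j) (n k l).
  rewrite !s0 !sn => <- //; first by do 4!move: (turn _ _ _); do 4!case.
  move=> e f em fm; apply: (@common_half_plane d).
    by apply: far => //; apply: ltnW.
  have [] := step _ _ _ em; have [] := step _ _ _ fm => /=.
  rewrite !ltr_norml => /andP[? ?] /andP[? ?] /andP[? ?] /andP[? ?].
  by split; split; apply/andP; split; lra.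
pose o0 : 'I_3 := ord0; pose o1 : 'I_3 := lift ord0 ord0; pose o2 : 'I_3 := ord_max.
pose T k j l := turn (b j) (s k l) (n k l).
(* For fixed rows [i] and [k], each turn around [a i] or [a k] occurs for two pairs of columns and
   cancels; the turns around the points [b j] add up to [M i] and [M k]. *)
pose M k := T k o0 o1 (+) T k o0 o2 (+) T k o1 o0 (+) T k o1 o2 (+) T k o2 o0 (+) T k o2 o1.
have ME i k : i != k -> M i (+) M k = true.
  move=> ik.
  have L j l : j != l -> lex_pos (b l - b j) = ~~ lex_pos (b j - b l).
    move=> jl; rewrite -opprB.
    have [h [hx _ _ _]] : exists h, [/\ half_plane h (b j - b l),
        half_plane h (b j - b l), half_plane h (b j - b l) & half_plane h (b j - b l)].
      have d_gt0 : 0 < d.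
        have [] := step i j 0%N (n_gt0 i j) => /(le_lt_trans (normr_ge0 _)); lra.
      apply: (@common_half_plane d); rewrite ?subrr ?normr0 //.
      by rewrite -(sn k) -(sn i); apply: far; rewrite // 1?eq_sym // 1?eq_sym.
    exact: lex_posN hx.
  rewrite /M /T (E i o0 k o1) // (E i o0 k o2) // (E i o1 k o0) // (E i o1 k o2) //.
  rewrite (E i o2 k o0) // (E i o2 k o1) //.
  by rewrite (L o0 o1) // (L o0 o2) // (L o1 o2) //; apply: K33_parity.
(* Three Booleans cannot be pairwise different. *)
by move: (ME o0 o1 isT) (ME o0 o2 isT) (ME o1 o2 isT); do 3!case: (M _).
Qed.
End CrossingParity.

(** * Plane drawings *)

From mathcomp Require Import all_classical all_reals all_analysis.

Import numFieldNormedType.Exports.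

(** * Chains with small steps, and distance from closed sets *)

Section Chains.
Local Open Scope classical_set_scope.
Local Open Scope ring_scope.
Variables (R : realType) (V : normedModType R).
Implicit Types (A B C D : set V) (x y z : V).

(** Chains stand in for curves: a connected set has them for every step size, whether or not it is
    path connected. *)
Inductive chain (e : R) A x : V -> Prop :=
| chain_refl : A x -> chain e A x x
| chain_step y z : chain e A x y -> A z -> `|y - z| < e -> chain e A x z.

Lemma chain_trans e A x y z : chain e A x y -> chain e A y z -> chain e A x z.
Proof. by move=> xy; elim=> // {}y' {}z _ xy' Az yz; apply: chain_step yz. Qed.

Lemma chain_sub e A B x y : A `<=` B -> chain e A x y -> chain e B x y.
Proof.
move=> AB; elim=> [/AB|{}y z _ xy /AB Bz yz]; first exact: chain_refl.
exact: chain_step yz.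
Qed.

Lemma chain_seq e A x y : 0 < e -> chain e A x y ->
  exists n (s : nat -> V), [/\ s 0%N = x, s n.+1 = y,
    forall k, (k <= n.+1)%N -> A (s k) &
    forall k, (k < n.+1)%N -> `|s k - s k.+1| < e].
Proof.
move=> e_gt0; elim=> [Ax|{}y z _ [n [s [s0 sn As step]]] Az yz].
  by exists 0%N, (fun=> x); split=> // k _; rewrite subrr normr0.
exists n.+1, (fun k => if (k <= n.+1)%N then s k else z); split=> //=.
- by rewrite ltnn.
- by move=> k _; case: ifP => // /As.
- move=> k; rewrite ltnS => kn; rewrite kn; case: ltngtP kn => // [kn|->] _.
    exact: step.
  by rewrite sn.
Qed.

(** The points reached from [x] form a nonempty part of [A] that is open and closed in [A]. *)
Lemma connected_chain e A x y : connected A -> 0 < e -> A x -> A y -> chain e A x y.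
Proof.
move=> cA e_gt0 Ax Ay; pose B := [set z | A z /\ chain e A x z].
suff BA : B = A by have [] : B y by rewrite BA.
have ball_step z w : B z -> A w -> `|z - w| < e -> B w.
  by move=> [_ xz] Aw zw; split=> //; apply: chain_step zw.
apply: cA.
- by exists x; split=> //; apply: chain_refl.
- exists (\bigcup_(z in B) ball z e); first by apply: bigcup_open => z _; exact: ball_open.
  apply/seteqP; split=> [z Bz|z [Az [w Bw wz]]].
    by split; [case: Bz|exists z => //; exact: ballxx].
  by apply: ball_step Bw Az _; rewrite -ball_normE in wz.
- exists (~` \bigcup_(z in A `\` B) ball z e).
    by apply: open_closedC; apply: bigcup_open => z _; exact: ball_open.
  apply/seteqP; split=> [z Bz|z [Az nz]].
    split; first by case: Bz.
    move=> [w [Aw nBw]]; rewrite -ball_normE /= distrC => wz.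
    exact/nBw/(ball_step _ _ Bz Aw).
  apply: contrapT => nBz; apply: nz; exists z => //; exact: ballxx.
Qed.

Lemma segment_chain e x y : 0 < e -> chain e [set z | `|z - x| <= `|y - x|] x y.
Proof.
move=> e_gt0; pose g (t : R) : V := x + t *: (y - x).
have cg : continuous g.
  by move=> t; apply: cvgD; [exact: cvg_cst|apply: cvgZr_tmp; exact: cvg_id].
apply: (@chain_sub _ (g @` `[0, 1])) => [_ [t /= + <-]|].
  rewrite in_itv /= => /andP[t0 t1]; rewrite /g addrC addKr normrZ ger0_norm //.
  exact: ler_piMl.
apply: connected_chain => //.
- apply: connected_continuous_connected; first exact: segment_connected.
  exact: continuous_subspaceT.
- by exists 0; rewrite /= ?in_itv /= ?lexx ?ler01 // /g scale0r addr0.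
- by exists 1; rewrite /= ?in_itv /= ?lexx ?ler01 // /g scale1r addrC subrK.
Qed.

Definition far (d : R) D : set V := [set z | forall w, D w -> d <= `|z - w|].

Lemma far_le d d' D : d' <= d -> far d D `<=` far d' D.
Proof. by move=> dd z fz w /fz; apply: le_trans. Qed.

Lemma far_sub d D D' : D' `<=` D -> far d D `<=` far d D'.
Proof. by move=> DD z fz w /DD/fz. Qed.

Lemma closed_far D x : closed D -> ~ D x -> exists2 d, 0 < d & far d D x.
Proof.
move=> cD nDx; have /nbhs_ballP[d /= d_gt0 xd] : nbhs x (~` D).
  by apply: open_nbhs_nbhs; split=> //; exact: closed_openC.
exists d => // w Dw; rewrite leNgt; apply/negP => xw.
by apply: (xd w) => //; rewrite -ball_normE.
Qed.

Lemma ball_far d D x z : far d D x -> `|z - x| <= d / 2 -> far (d / 2) D z.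
Proof.
move=> fx zx w /fx dw; have := ler_distD z x w; rewrite distrC in zx; lra.
Qed.

(** The point is a single margin [d] for all step sizes, although [C] may come arbitrarily close to
    [D]. The points reached with some margin are again open and closed in [C]. *)
Lemma connected_chain_far C D x y : closed D -> connected C -> C `&` D = set0 ->
  C x -> C y -> exists2 d, 0 < d & forall e, 0 < e -> chain e (far d D) x y.
Proof.
move=> cD cC CD Cx Cy.
pose B := [set z | C z /\ exists2 d, 0 < d & forall e, 0 < e -> chain e (far d D) x z].
suff BC : B = C by have [] : B y by rewrite BC.
have C_far z : C z -> exists2 d, 0 < d & far d D z.
  move=> Cz; apply: closed_far => // Dz.
  by have : (C `&` D) z by []; rewrite CD.
(* One end has margin [d] and the jump is shorter than [d / 4], so the whole segment keeps margin
   [d / 2]. *)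
have ball_step z w d : 0 < d -> B z -> C w -> far d D z \/ far d D w ->
    `|w - z| < d / 4 -> B w.
  move=> d_gt0 [_ [d' d'_gt0 xz]] Cw fzw zw; split=> //.
  exists (Num.min d' (d / 2)); first by rewrite lt_min d'_gt0; lra.
  move=> e e_gt0; apply: (@chain_trans _ _ _ z).
    by apply: chain_sub (xz _ e_gt0); apply: far_le; rewrite ge_min lexx.
  apply: chain_sub (segment_chain _ _ e_gt0) => u /= uz.
  apply: (@far_le (d / 2)); first by rewrite ge_min lexx orbT.
  case: fzw => fzw; apply: ball_far fzw _; first by lra.
  by have := ler_distD z u w; rewrite (distrC z w); lra.
have Bx : B x.
  split=> //; have [d d_gt0 fx] := C_far x Cx; exists d => // e _; exact: chain_refl.
apply: cC; first by exists x.
- exists (\bigcup_(dz in [set dz : R * V | [/\ 0 < dz.1, B dz.2 & far dz.1 D dz.2]])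
     ball dz.2 (dz.1 / 4)).
    by apply: bigcup_open => z _; exact: ball_open.
  apply/seteqP; split=> [z /[dup] Bz [Cz _]|z [Cz [[d w] [/= d_gt0 Bw fw]]]].
    split=> //; have [d d_gt0 fz] := C_far z Cz.
    by exists (d, z) => //=; apply: ballxx; rewrite divr_gt0.
  rewrite -ball_normE /= distrC => wz.
  by apply: ball_step Bw Cz _ wz => //; left.
- exists (~` \bigcup_(dz in [set dz : R * V |
      [/\ 0 < dz.1, C dz.2, ~ B dz.2 & far dz.1 D dz.2]]) ball dz.2 (dz.1 / 4)).
    by apply: open_closedC; apply: bigcup_open => z _; exact: ball_open.
  apply/seteqP; split=> [z /[dup] Bz [Cz _]|z [Cz nz]].
    split=> // -[[d w] [/= d_gt0 Cw nBw fw]].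
    rewrite -ball_normE /= => wz; apply: nBw.
    by apply: ball_step Bz Cw _ wz => //; right.
  apply: contrapT => nBz; have [d d_gt0 fz] := C_far z Cz.
  by apply: nz; exists (d, z) => //=; apply: ballxx; rewrite divr_gt0.
Qed.

Lemma compact_separation A B : compact A -> compact B -> A `&` B = set0 ->
  exists2 d, 0 < d & forall x y, A x -> B y -> d <= `|x - y|.
Proof.
move=> cA cB AB.
have [[[x y] /= [Ax By]]|/forallNP nAB] := pselect ((A `*` B) !=set0); last first.
  by exists 1 => // x y Ax By; case: (nAB (x, y)).
pose f (p : V * V) := `|p.1 - p.2|.
have cf : {within A `*` B, continuous f}.
  apply: continuous_subspaceT => p; apply: cvg_norm; apply: cvgB.
    exact: cvg_fst.
  exact: cvg_snd.
have [|[u v] uv min_uv] := compact_EVT_min _ (compact_setX cA cB) cf.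
  by exists (x, y).
exists (f (u, v)); last by move=> x' y' Ax' By'; apply: (min_uv (x', y')); rewrite inE.
rewrite normr_gt0 subr_eq0; apply/eqP => /= euv; move: uv; rewrite inE /= => -[Au Bv].
have : (A `&` B) v by split=> //; rewrite -euv.
by rewrite AB.
Qed.
End Chains.

Lemma exists_common_pos (R : realType) (I : finType) (P : I -> R -> Prop) :
  (forall i d d', P i d -> d' <= d -> P i d')%R ->
  (forall i, exists2 d, 0 < d & P i d)%R -> exists2 d, (0 < d)%R & forall i, P i d.
Proof.
move=> Ple Pex; have /choice[d dP] : forall i, exists d, (0 < d)%R /\ P i d.
  by move=> i; have [d] := Pex i; exists d.
exists (\big[Num.min/1%R]_i d i)%R.
  by apply/bigmin_gtP; split=> // i _; case: (dP i).
by move=> i; have [_ /Ple] := dP i; apply; apply: bigmin_le_cond.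
Qed.

Lemma K33_connected_meet (R : realType) (a b : 'I_3 -> R * R)
    (E : 'I_3 -> 'I_3 -> set (R * R)) (d : R) :
  (0 < d)%R ->
  (forall i j e, (0 < e)%R -> chain e (E i j) (a i) (b j)) ->
  (forall i j k l x y, i != k -> j != l -> E i j x -> E k l y -> d <= `|x - y|)%R ->
  False.
Proof.
move=> d_gt0 Ech far.
have d2_gt0 : (0 < d / 2)%R by lra.
have prod_normE (x : R * R) : `|x|%R = Num.max `|x.1|%R `|x.2|%R by [].
have ex ij : exists ns : nat * (nat -> R * R), [/\ ns.2 0 = a ij.1, ns.2 ns.1.+1 = b ij.2,
    forall k, k <= ns.1.+1 -> E ij.1 ij.2 (ns.2 k) &
    forall k, k < ns.1.+1 -> (`|ns.2 k - ns.2 k.+1| < d / 2)%R].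
  by have [n [s sP]] := chain_seq d2_gt0 (Ech ij.1 ij.2 _ d2_gt0); exists (n, s).
have /choice[ns nsP] := ex.
apply: (@K33_chains_meet R d a b (fun i j => (ns (i, j)).2) (fun i j => (ns (i, j)).1.+1)).
- by move=> i j; case: (nsP (i, j)).
- by move=> i j; case: (nsP (i, j)).
- by [].
- move=> i j k kn; have [_ _ _ /(_ k kn)] := nsP (i, j).
  by rewrite prod_normE gt_max => /andP.
- move=> i j k l e f ik jl en fn.
  have [_ _ /(_ e en) Ee _] := nsP (i, j); have [_ _ /(_ f fn) Ef _] := nsP (k, l).
  have := far _ _ _ _ _ _ ik jl Ee Ef; rewrite distrC prod_normE le_max => /orP.
  exact.
Qed.

(** * Drawn vertex sets and the outer face *)

Section Drawings.
Local Open Scope classical_set_scope.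
Local Open Scope ring_scope.
Variable R : realType.

Lemma finite_bigcup_compact (T : topologicalType) (I : finType) (P : {pred I})
    (F : I -> set T) :
  (forall i, i \in P -> compact (F i)) -> compact (\bigcup_(i in [set` P]) F i).
Proof. by move=> cF; rewrite bigcup_pred; apply: bigsetU_compact. Qed.

(* The hub q lies in F; together with a, b it is joined to p 0, p 1, p 2,
   which gives a K_{3,3}. *)
Lemma no_accessible_theta (A B : 'I_3 -> set (R * R)) (p : 'I_3 -> R * R)
    (a b : R * R) (F : set (R * R)) :
  (forall i, compact (A i)) -> (forall i, compact (B i)) ->
  (forall i e, 0 < e -> chain e (A i) a (p i)) ->
  (forall i e, 0 < e -> chain e (B i) b (p i)) ->
  (forall i j, i != j -> A i `&` B j = set0) ->
  (forall i j, i != j -> ~ (A j `|` B j) (p i)) ->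
  connected F -> (forall i, F `&` (A i `|` B i) = set0) ->
  (forall i, closure F (p i)) -> False.
Proof.
move=> cA cB chA chB AB nAB conF FAB clF.
pose D := \bigcup_i (A i `|` B i).
(* Only the edges of K_{3,3} independent of the one from the hub to [p j]; that edge may meet [A j]
   and [B j]. *)
pose D' j := \bigcup_(i in [set i | i != j]) (A i `|` B i).
have clAB i : closed (A i `|` B i).
  by apply: compact_closed; [exact: norm_hausdorff|exact: compactU].
have clD : closed D by apply: closed_bigcup => //; exact: finite_finset.
have clD' j : closed (D' j) by apply: closed_bigcup => //; exact: finite_finset.
have D'D j : D' j `<=` D by move=> x [i _ ix]; exists i.
have FD : F `&` D = set0.
  apply/seteqP; split=> // x [Fx [i _ ix]].
  by have : (F `&` (A i `|` B i)) x by []; rewrite FAB.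
have nD' j : ~ D' j (p j) by move=> [i /= ij]; apply: nAB; rewrite eq_sym.
(* As [p j] is off the closed set [D' j], a point of [F] close to [p j] is joined to it by a segment
   with positive margin. *)
have near_p j : exists q, F q /\ exists2 d, 0 < d & forall e, 0 < e -> chain e (far d (D' j)) q (p j).
  have [d d_gt0 fp] := closed_far (clD' j) (nD' j).
  have d4_gt0 : 0 < d / 4 by rewrite divr_gt0.
  have [q [Fq]] := clF j _ (nbhsx_ballx (p j) _ d4_gt0).
  rewrite -ball_normE /= => pq; exists q; split=> //.
  exists (d / 2); first by rewrite divr_gt0.
  move=> e e_gt0; apply: chain_sub (segment_chain _ _ e_gt0) => z /= zq.
  apply: ball_far fp _; have := ler_distD q z (p j); rewrite (distrC q (p j)); lra.
have /choice[q qP] := near_p.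
have hub j : exists2 d, 0 < d & forall e, 0 < e -> chain e (far d (D' j)) (q ord0) (p j).
  have [Fq [d d_gt0 ch]] := qP j; have [Fq0 _] := qP ord0.
  have [d' d'_gt0 ch'] := connected_chain_far clD conF FD Fq0 Fq.
  exists (Num.min d d'); first by rewrite lt_min d_gt0.
  move=> e e_gt0; apply: (@chain_trans _ _ _ _ _ (q j)).
    apply: chain_sub (ch' e e_gt0) => z /(far_sub (D'D j)).
    by apply: far_le; rewrite ge_min lexx orbT.
  by apply: chain_sub (ch e e_gt0); apply: far_le; rewrite ge_min lexx.
have [d1 d1_gt0 hub1] : exists2 d, 0 < d & forall j e, 0 < e ->
    chain e (far d (D' j)) (q ord0) (p j).
  apply: (@exists_common_pos _ _ (fun j d => forall e, 0 < e ->
    chain e (far d (D' j)) (q ord0) (p j))) hub => j d d' ch dd e e_gt0.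
  by apply: chain_sub (ch e e_gt0); apply: far_le.
have [d2 d2_gt0 sepAB] : exists2 d, 0 < d & forall ij : 'I_3 * 'I_3, ij.1 != ij.2 ->
    forall x y, A ij.1 x -> B ij.2 y -> d <= `|x - y|.
  apply: (@exists_common_pos _ _ (fun ij d => ij.1 != ij.2 ->
    forall x y, A ij.1 x -> B ij.2 y -> d <= `|x - y|)) => [ij d d' sep dd ne x y Ax By|ij].
    by apply: le_trans dd _; apply: sep.
  have [->|ne] := eqVneq ij.1 ij.2; first by exists 1.
  by have [d d_gt0 sep] := compact_separation (cA _) (cB _) (AB _ _ ne); exists d.
(* The third row holds no drawn edge but the whole region at distance [d1] from the sets it must
   avoid; the hub chains run inside it. *)
pose E (i j : 'I_3) : set (R * R) := match val i with
  | 0%N => A j | 1%N => B j | _ => far d1 (D' j) end.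
pose c (i : 'I_3) := match val i with 0%N => a | 1%N => b | _ => q ord0 end.
apply: (@K33_connected_meet R c p E (Num.min d1 d2)).
- by rewrite lt_min d1_gt0.
- by move=> [[|[|[|//]]] ?] j e e_gt0; rewrite /E /c /=; [exact: chA|exact: chB|exact: hub1].
- have hubD j l x y : j != l -> far d1 (D' l) y -> (A j `|` B j) x ->
      Num.min d1 d2 <= `|x - y|.
    move=> jl fy ABx; apply: (@le_trans _ _ d1); first by rewrite ge_min lexx.
    by rewrite distrC; apply: fy; exists j.
  have sepAB' j l x y : j != l -> A j x -> B l y -> Num.min d1 d2 <= `|x - y|.
    move=> jl Ax By; apply: (@le_trans _ _ d2); first by rewrite ge_min lexx orbT.
    exact: (sepAB (j, l)).
  move=> [[|[|[|//]]] ?] j [[|[|[|//]]] ?] l x y; rewrite -val_eqE /E //= => _ jl Ex Ey.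
  + exact: sepAB' Ex Ey.
  + by apply: (hubD _ _ _ _ jl Ey); left.
  + by rewrite distrC; apply: sepAB' Ey Ex; rewrite eq_sym.
  + by apply: (hubD _ _ _ _ jl Ey); right.
  + by rewrite eq_sym in jl; rewrite distrC; apply: (hubD _ _ _ _ jl Ex); left.
  + by rewrite eq_sym in jl; rewrite distrC; apply: (hubD _ _ _ _ jl Ex); right.
Qed.

Variables (G : sgraph) (pos : G -> R * R) (arc : {set G} -> R -> R * R).
Hypothesis drawingP : plane_drawing pos arc.

(** The drawing of the subgraph induced by [X]. *)
Definition drawn (X : {set G}) : set (R * R) :=
  pos @` [set` X] `|`
  \bigcup_(e in [set` [pred e | (e \in edges G) && (e \subset X)]]) arc e @` `[0, 1].

Lemma drawn_compact X : compact (drawn X).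
Proof.
have [_ arcP _ _] := drawingP; apply: compactU; last first.
  apply: finite_bigcup_compact => e; rewrite inE => /andP[/arcP[ce _ _] _].
  by apply: continuous_compact => //; apply: segment_compact.
have -> : pos @` [set` X] = \bigcup_(v in [set` X]) [set pos v].
  by apply/seteqP; split=> [_ [v vX <-]|_ [v vX ->]]; exists v.
by apply: finite_bigcup_compact => v _; apply: compact_set1.
Qed.

Lemma drawn_sub X : drawn X `<=` drawing_image pos arc.
Proof.
move=> x [[v _ <-]|[e /=]]; first by left; exists v.
by rewrite inE => /andP[eG _] ex; right; exists e.
Qed.

(** The vertices of [X] chained to [u] cannot be a proper part of [X]: some edge would leave it, and
    the arc of that edge is connected. *)
Lemma drawn_chain X u v e : conn X -> u \in X -> v \in X -> 0 < e ->
  chain e (drawn X) (pos u) (pos v).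
Proof.
move=> [X0 cX] uX vX e_gt0; have [_ arcP _ _] := drawingP.
pose A := [set w in X | `[< chain e (drawn X) (pos u) (pos w) >]]%SET.
suff AX : A = X.
  have : v \in A by rewrite AX.
  by rewrite inE => /andP[_ /asboolP].
apply/eqP; apply: contraT => neA.
have /touchP[x [y []]] : touch A (X :\: A).
  apply: cX => //; last by apply/fintype.subsetP => w; rewrite inE => /andP[].
  apply/finset.set0Pn; exists u; rewrite inE uX; apply/asboolP/chain_refl.
  by left; exists u.
rewrite !inE => /andP[xX /asboolP ux] /andP[+ yX] xy; rewrite yX /= => /asboolP[].
have eG : [set x; y]%SET \in edges G.
  by rewrite inE; apply/existsP; exists x; apply/existsP; exists y; rewrite xy eqxx.
have sX : [set x; y]%SET \subset X by rewrite finset.subUset !finset.sub1set xX.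
have [ce _ ends] := arcP _ eG.
apply: chain_trans ux _.
apply: (@chain_sub _ _ _ (arc [set x; y]%SET @` `[0, 1])).
  by move=> z zE; right; exists [set x; y]%SET => //=; rewrite inE eG.
have in_arc w : w \in [set x; y]%SET -> (arc [set x; y]%SET @` `[0, 1]) (pos w).
  move=> wxy; have : (pos @` [set` [set x; y]%SET]) (pos w) by exists w.
  by rewrite -ends => -[->|->]; [exists 0|exists 1] => //; rewrite /= in_itv /= lexx ler01.
apply: connected_chain => //; try by apply: in_arc; rewrite !inE eqxx ?orbT.
by apply: connected_continuous_connected => //; apply: segment_connected.
Qed.

Lemma arc_cases e x : e \in edges G -> (arc e @` `[0, 1]) x ->
  (arc e @` `]0, 1[) x \/ exists2 v, v \in e & x = pos v.
Proof.
move=> eG [t /= + <-]; rewrite in_itv /= => /andP[t0 t1].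
have [_ arcP _ _] := drawingP; have [_ _ ends] := arcP e eG.
have endP s : s = 0 \/ s = 1 -> exists2 v, v \in e & arc e s = pos v.
  move=> s01; have : [set arc e 0; arc e 1] (arc e s) by case: s01 => ->; [left|right].
  by rewrite ends => -[v ve <-]; exists v.
case: (ltgtP t 0) t0 => // [t_gt0 _|->]; last by right; apply: endP; left.
case: (ltgtP t 1) t1 => // [t_lt1 _|->]; last by right; apply: endP; right.
by left; exists t => //; rewrite /= in_itv /= t_gt0.
Qed.

Lemma drawn_disjoint (X Y : {set G}) : [disjoint X & Y]%B -> drawn X `&` drawn Y = set0.
Proof.
move=> XY; apply/seteqP; split=> // x [].
have [pos_inj _ arc_pos arc_arc] := drawingP.
have cases (Z : {set G}) : drawn Z x -> (exists2 v, v \in Z & x = pos v) \/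
    exists e, [/\ e \in edges G, e \subset Z & (arc e @` `]0, 1[) x].
  move=> [[v vZ <-]|[e /= +]]; first by left; exists v.
  rewrite inE => /andP[eG eZ] /(arc_cases eG)[ex|[v ve ->]]; first by right; exists e.
  by left; exists v => //; apply: (fintype.subsetP eZ).
have no_pos e v : e \in edges G -> (arc e @` `]0, 1[) x -> x = pos v -> False.
  move=> eG ex xv; have : (arc e @` `]0, 1[ `&` range pos) x by split=> //; exists v.
  by rewrite arc_pos.
move=> /cases[[v vX xv]|[e [eG eX ex]]] /cases[[w wY xw]|[f [fG fY fx]]].
- by move: xw; rewrite xv => /pos_inj vw; move: (disjointFr XY vX); rewrite vw wY.
- exact: no_pos fx xv.
- exact: no_pos ex xw.
- have ef : e != f.
    apply: contraTneq XY => ef; rewrite -finset.setI_eq0; apply/finset.set0Pn.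
    move: eG; rewrite inE => /existsP[u /existsP[v /andP[_ /eqP euv]]].
    by exists u; rewrite inE (fintype.subsetP eX) ?(fintype.subsetP fY) -?ef ?euv ?inE ?eqxx.
  have : (arc e @` `]0, 1[ `&` arc f @` `]0, 1[) x by [].
  by rewrite arc_arc.
Qed.
End Drawings.

(** The edges to [p i] are the drawings of [X] and of [Y], each united with [P i]. For different
    indices the [X] part and the [Y] part are disjoint, while those of one index share [P i], as
    edges with a common end may. The point [p i] is any vertex of [P i], all vertices being on the
    outer face. *)
Theorem outerplanar_K23_minor_free (R : realType) (G : sgraph) :
  outerplanar R G -> K23_minor_free G.
Proof.
move=> [pos [arc [dP [F [[x _ FE] _] Fpos]]]] X Y P cX cY cP XY XP YP PP tX tY.
have ex i : exists v, v \in P i by have [/finset.set0Pn] := cP i.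
have /choice[v vP] := ex.
have [[x0 x0X] [y0 y0Y]] : (exists x, x \in X) /\ (exists y, y \in Y).
  by split; apply/finset.set0Pn; [case: cX|case: cY].
have cXP i : conn (X :|: P i) by apply: connU.
have cYP i : conn (Y :|: P i) by apply: connU.
have disjU (A B C : {set G}) : [disjoint A & C] -> [disjoint B & C] ->
    [disjoint (A :|: B)%SET & C].
  by rewrite -!finset.setI_eq0 finset.setIUl => /eqP-> /eqP->; rewrite finset.setU0.
have vXP i : v i \in X :|: P i by rewrite inE vP orbT.
have vYP i : v i \in Y :|: P i by rewrite inE vP orbT.
have pos_drawn (Z : {set G}) w : w \in Z -> drawn pos arc Z (pos w) by move=> wZ; left; exists w.
have pos_notin (Z : {set G}) w : [disjoint Z & [set w]%SET] -> ~ drawn pos arc Z (pos w).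
  move=> Zw dw; have : (drawn pos arc Z `&` drawn pos arc [set w]%SET)%classic (pos w).
    by split=> //; apply: pos_drawn; rewrite inE.
  by rewrite drawn_disjoint.
have disj1 i j : i != j -> [disjoint X :|: P j & [set v i]%SET] /\
    [disjoint Y :|: P j & [set v i]%SET].
  move=> ij; rewrite !(disjoint_sym _ [set v i]%SET) !disjoints1 !inE.
  rewrite (disjointFl (XP i) (vP i)) (disjointFl (YP i) (vP i)).
  by rewrite (disjointFr (PP i j ij) (vP i)).
apply: (@no_accessible_theta R (fun i => drawn pos arc (X :|: P i))
  (fun i => drawn pos arc (Y :|: P i)) (fun i => pos (v i)) (pos x0) (pos y0) F).
- by move=> i; apply: drawn_compact.
- by move=> i; apply: drawn_compact.
- by move=> i e e_gt0; apply: drawn_chain => //; rewrite inE x0X.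
- by move=> i e e_gt0; apply: drawn_chain => //; rewrite inE y0Y.
- move=> i j ij; apply: drawn_disjoint => //.
  apply: (disjU); rewrite disjoint_sym; apply: (disjU) => //; rewrite disjoint_sym //.
  exact: PP.
- by move=> i j /disj1[d1 d2] [|]; apply: pos_notin.
- by rewrite FE; apply: component_connected.
- move=> i; apply/seteqP; split=> // z []; rewrite FE => /connected_component_sub nz.
  by move=> [|] /(@drawn_sub _ _ _ _ _ _).
- by move=> i; have [] := Fpos (v i).
Qed.

Theorem theorem19 (R : realType) (G : sgraph)
    (G_triangle_free : triangle_free G) (G_outerplanar : outerplanar R G) :
  chi_vi G 1 isT <= max_degree G + 3.
Proof.
have [f [g fgP]] := valid_exists [set: G]%SET G_triangle_free
  (outerplanar_K23_minor_free G_outerplanar).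
rewrite addn3 /chi_vi; case: ex_minnP => m _; apply.
by apply/asboolP; exists (incidence_colour f g); apply: incidence_colour_ok.
Qed.
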